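(* Let $k$ be a field, $G$ a finite group, and $X$ a set of representatives of the conjugacy classes of $G$. For $x,y\in X$ and classes $[\widehat\varphi_x]\in H^n(C_G(x),k)$, $[\widehat\varphi_y]\in H^m(C_G(y),k)$ represented by cocycles $\widehat\varphi_x:\overline{C_G(x)}^{\times n}\to k$ and $\widehat\varphi_y:\overline{C_G(y)}^{\times m}\to k$, define $$[\widehat\varphi_x\cup\widehat\varphi_y]=\sum_{z\in X}[(\widehat\varphi_x\cup\widehat\varphi_y)_z]\in\bigoplus_{z\in X}H^*(C_G(z),k),$$ where $(\widehat\varphi_x\cup\widehat\varphi_y)_z:\overline{C_G(z)}^{\times(n+m)}\to k$ is given by $$(\widehat\varphi_x\cup\widehat\varphi_y)_z(h_1,\dots,h_{n+m})=\sum_{(i,j)\in I_1'}\widehat\varphi_x(h_{i,1},\dots,h_{i,n})\,\widehat\varphi_y(h_{j,1},\dots,h_{j,m}).$$ Here $I_1'$ is the set of pairs $(i,j)$, $1\le i\le n_x$, $1\le j\le n_y$, such that $$x_i\,h_1\cdots h_n\,y_j\,(h_1\cdots h_n)^{-1}=z,$$ the elements $h_{i,1},\dots,h_{i,n}\in C_G(x)$ are determined by $$\gamma_{i,x}h_1=h_{i,1}\gamma_{s_i^1,x},\quad\gamma_{s_i^1,x}h_2=h_{i,2}\gamma_{s_i^2,x},\quad\dots,\quad\gamma_{s_i^{n-1},x}h_n=h_{i,n}\gamma_{s_i^n,x},$$ and the elements $h_{j,1},\dots,h_{j,m}\in C_G(y)$ are determined by $$\gamma_{j,y}h_{n+1}=h_{j,1}\gamma_{s_j^1,y},\quad\gamma_{s_j^1,y}h_{n+2}=h_{j,2}\gamma_{s_j^2,y},\quad\dots,\quad\gamma_{s_j^{m-1},y}h_{n+m}=h_{j,m}\gamma_{s_j^m,y}.$$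 With this product on $\bigoplus_{x\in X}H^*(C_G(x),k)$, the linear isomorphism $$HH^*(kG)\xrightarrow{\ \sim\ }\bigoplus_{x\in X}H^*(C_G(x),k)$$ which, for $x\in X$, sends the class of a cocycle $\varphi_x\in\mathcal{H}_x^n$ to the class of $\widehat\varphi_x:\overline{C_G(x)}^{\times n}\to k$, $\widehat\varphi_x(h_1,\dots,h_n)=$ the coefficient of $x$ in $\varphi_x(h_1,\dots,h_n)h_n^{-1}\cdots h_1^{-1}$, is an isomorphism of graded algebras, where $HH^*(kG)$ carries the cup product.
   Context: For a group $H$ write $\overline{H}=H\setminus\{1\}$. For a $k$-vector space $V$, $\mathrm{Map}(\overline{H}^{\times n},V)$ denotes all maps of sets, identified with $\mathrm{Hom}_k((kH/k\cdot 1)^{\otimes n},V)$ (and with $V$ for $n=0$); accordingly, in every formula such a map takes the value $0$ whenever one of its arguments equals $1$. Hochschild cohomology: $HH^*(kG)$ is the cohomology of $\mathcal{H}^n=\mathrm{Map}(\overline{G}^{\times n},kG)$ with differential $\delta_0(a)(g)=ga-ag$ and $$\delta_n(\varphi)(g_1,\dots,g_{n+1})=g_1\varphi(g_2,\dots,g_{n+1})+\sum_{i=1}^n(-1)^i\varphi(g_1,\dots,g_ig_{i+1},\dots,g_{n+1})+(-1)^{n+1}\varphi(g_1,\dots,g_n)g_{n+1}.$$ The cup product on $HH^*(kG)$ is induced by $(\varphi\cup\psi)(g_1,\dots,g_{n+m})=\varphi(g_1,\dots,g_n)\psi(g_{n+1},\dots,g_{n+m})$. Group cohomology: for a finite group $H$,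 $H^*(H,k)$ (trivial coefficients) is the cohomology of $\mathrm{Map}(\overline{H}^{\times n},k)$ with $$\delta_n(\psi)(h_1,\dots,h_{n+1})=\psi(h_2,\dots,h_{n+1})+\sum_{i=1}^n(-1)^i\psi(h_1,\dots,h_ih_{i+1},\dots,h_{n+1})+(-1)^{n+1}\psi(h_1,\dots,h_n).$$ For $x\in X$: $C_x$ is the conjugacy class of $x$, $C_G(x)$ the centralizer of $x$, $n_x=|C_x|=[G:C_G(x)]$; fix right coset representatives $\gamma_{1,x}=1,\gamma_{2,x},\dots,\gamma_{n_x,x}$, so that $G=\bigsqcup_{i=1}^{n_x}C_G(x)\gamma_{i,x}$, and put $x_i=\gamma_{i,x}^{-1}x\gamma_{i,x}$, so $C_x=\{x_1=x,x_2,\dots,x_{n_x}\}$; similarly $y_j=\gamma_{j,y}^{-1}y\gamma_{j,y}$ for $y\in X$. Since the cosets are disjoint, for $g\in G$ and $1\le i\le n_x$ the equation $\gamma_{i,x}g=h\gamma_{s,x}$ determines $h\in C_G(x)$ and the index $s$ uniquely. For $x\in X$, $\mathcal{H}_x^0=kC_x$ and, for $n\ge1$, $\mathcal{H}_x^n$ is the space of maps $\varphi:\overline{G}^{\times n}\to kG$ such that $\varphi(g_1,\dots,g_n)$ lies in the $k$-span of the set $g_1\cdots g_nC_x$ for all $g_1,\dots,g_n\in\overline{G}$. One has a decomposition into subcomplexes $\mathcal{H}^*=\bigoplus_{x\in X}\mathcal{H}_x^*$. *)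

(* Defs.v *)
From HB Require Import structures.
From mathcomp Require Import all_boot all_order all_algebra all_fingroup.

Set Implicit Arguments.
Unset Strict Implicit.
Unset Printing Implicit Defensive.

Import GRing.Theory.
Local Open Scope ring_scope.
Local Open Scope quotient_scope.

(* The type {ffun gT -> k} already carries the pointwise product in the
   library, so the group algebra kG is an alias, with its own product. *)
Definition group_alg (k : fieldType) (gT : finGroupType) := {ffun gT -> k^o}.

Section GroupAlgebra.
Variables (k : fieldType) (gT : finGroupType).
Local Notation kG := (group_alg k gT).

HB.instance Definition _ := Vector.on kG.

Definition ga_elt (g : gT) : kG := [ffun x => (x == g)%:R].

Definition ga_mul (a b : kG) : kG := [ffun x => \sum_(g : gT) a g * b (g^-1 * x)%g].

Fact ga_mulA : associative ga_mul.
Proof.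
move=> a b c; apply/ffunP=> x; rewrite !ffunE.
under eq_bigr do rewrite ffunE mulr_sumr.
under [RHS]eq_bigr do rewrite ffunE mulr_suml.
rewrite [RHS]exchange_big; apply: eq_bigr => g _ /=.
rewrite [RHS](reindex_inj (mulgI g)) /=; apply: eq_bigr => h _.
by rewrite mulrA mulKg invMg mulgA.
Qed.

Fact ga_mul1l : left_id (ga_elt 1) ga_mul.
Proof.
move=> a; apply/ffunP=> x; rewrite ffunE (bigD1 1%g) //= ffunE eqxx mul1r.
rewrite invg1 mul1g big1 ?addr0 // => g /negPf g1.
by rewrite ffunE g1 mul0r.
Qed.

Fact ga_mul1r : right_id (ga_elt 1) ga_mul.
Proof.
move=> a; apply/ffunP=> x; rewrite ffunE (bigD1 x) //= ffunE mulVg eqxx mulr1.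
rewrite big1 ?addr0 // => g /negPf gx.
by rewrite ffunE -eq_mulVg1 gx mulr0.
Qed.

Fact ga_mulDl : left_distributive ga_mul +%R.
Proof.
move=> a b c; apply/ffunP=> x; rewrite !ffunE -big_split /=.
by apply: eq_bigr => g _; rewrite ffunE mulrDl.
Qed.

Fact ga_mulDr : right_distributive ga_mul +%R.
Proof.
move=> a b c; apply/ffunP=> x; rewrite !ffunE -big_split /=.
by apply: eq_bigr => g _; rewrite ffunE mulrDr.
Qed.

Fact ga_1neq0 : ga_elt 1 != 0.
Proof.
by apply/eqP => /ffunP/(_ 1%g)/eqP; rewrite !ffunE eqxx oner_eq0.
Qed.

HB.instance Definition _ := GRing.Zmodule_isNzRing.Build kG
  ga_mulA ga_mul1l ga_mul1r ga_mulDl ga_mulDr ga_1neq0.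

Fact ga_scaleAl (c : k) (a b : kG) : c *: (a * b) = (c *: a) * b.
Proof.
apply/ffunP=> x; rewrite !ffunE scaler_sumr.
by apply: eq_bigr => g _; rewrite ffunE scalerAl.
Qed.

HB.instance Definition _ := GRing.Lmodule_isLalgebra.Build k kG ga_scaleAl.

Fact ga_scaleAr (c : k) (a b : kG) : c *: (a * b) = a * (c *: b).
Proof.
apply/ffunP=> x; rewrite !ffunE scaler_sumr.
by apply: eq_bigr => g _; rewrite ffunE scalerAr.
Qed.

HB.instance Definition _ := GRing.Lalgebra_isAlgebra.Build k kG ga_scaleAr.

End GroupAlgebra.

(* The quotient Z / (B :&: Z); below B is a subspace of Z. *)
Section Subquotient.
Variables (k : fieldType) (vT : vectType k) (Z B : {vspace vT}).

Definition subq_ker : {pred subvs_of Z} := fun z => vsval z \in B.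

Fact subq_ker_zmod_closed : zmod_closed subq_ker.
Proof.
by split=> [|u v Bu Bv]; rewrite unfold_in /= ?linear0 ?linearB /= ?mem0v ?rpredB.
Qed.

HB.instance Definition _ :=
  GRing.isZmodClosed.Build (subvs_of Z) subq_ker subq_ker_zmod_closed.

Definition subquot := Quotient.quot (subq_ker : zmodClosed _).

HB.instance Definition _ := EqQuotient.on subquot.
HB.instance Definition _ := ZmodQuotient.on subquot.

Definition subq_scale (a : k) (c : subquot) : subquot := \pi_subquot (a *: generic_quotient.repr c).

Fact subq_piZ a z : subq_scale a (\pi_subquot z) = \pi_subquot (a *: z).
Proof.
have kerZ u : u \in subq_ker -> a *: u \in subq_ker.
  by rewrite !unfold_in /subq_ker linearZ; exact: memvZ.
apply/eqP; rewrite -Quotient.idealrBE -scalerBr; apply: kerZ.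
by rewrite Quotient.idealrBE reprK.
Qed.

Fact subq_scaleA a b c : subq_scale a (subq_scale b c) = subq_scale (a * b) c.
Proof. by elim/quotW: c => z; rewrite (subq_piZ b) 2!subq_piZ scalerA. Qed.

Fact subq_scale1 : left_id 1 subq_scale.
Proof. by elim/quotW => z; rewrite subq_piZ scale1r. Qed.

Fact subq_scaleDr : right_distributive subq_scale +%R.
Proof.
move=> a; elim/quotW=> u; elim/quotW=> v.
by rewrite -raddfD !subq_piZ scalerDr raddfD.
Qed.

Fact subq_scaleDl c : {morph subq_scale^~ c : a b / a + b}.
Proof. by elim/quotW: c => z a b; rewrite !subq_piZ scalerDl raddfD. Qed.

HB.instance Definition _ := GRing.Zmodule_isLmodule.Build k subquot
  subq_scaleA subq_scale1 subq_scaleDr subq_scaleDl.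

(* c is the class of v; in particular, v belongs to Z. *)
Definition is_class (v : vT) (c : subquot) : Prop :=
  exists z : subvs_of Z, vsval z = v /\ c = \pi_subquot z.

End Subquotient.

Definition nontriv (gT : finGroupType) := {g : gT | g != 1%g}.

Definition Map (k : fieldType) (gT : finGroupType) (vT : vectType k) (n : nat) :=
  {ffun {ffun 'I_n -> nontriv gT} -> vT}.

HB.instance Definition _ k gT vT n := Vector.on (@Map k gT vT n).

(* The value of a cochain on arbitrary group elements: 0 if one of them is 1. *)
Definition mapev k gT vT n (phi : @Map k gT vT n) (g : {ffun 'I_n -> gT}) : vT :=
  if [pick t : {ffun 'I_n -> nontriv gT} | [forall i, val (t i) == g i]] is Some t
  then phi t else 0.

(* From (g_1, ..., g_{n+1}) to (g_1, ..., g_{i+1} g_{i+2}, ..., g_{n+1});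
   the index i starts at 0. *)
Definition merge_at (gT : finGroupType) n (g : {ffun 'I_n.+1 -> gT}) (i : 'I_n) :
    {ffun 'I_n -> gT} :=
  [ffun j : 'I_n => if (j < i)%N then g (widen_ord (leqnSn n) j)
     else if j == i then (g (widen_ord (leqnSn n) j) * g (lift ord0 j))%g
     else g (lift ord0 j)].

(* The complex Map(\bar H^n, vT), where H acts on vT on the left by actl and
   on the right by actr. *)
Section BarComplex.
Variables (k : fieldType) (gT : finGroupType) (vT : vectType k).
Variables (actl actr : gT -> {linear vT -> vT}).

Definition bar_diff n (phi : Map gT vT n) : Map gT vT n.+1 :=
  [ffun t : {ffun 'I_n.+1 -> nontriv gT} =>
     let g : {ffun 'I_n.+1 -> gT} := [ffun i => val (t i)] in
     actl (g ord0) (mapev phi [ffun i : 'I_n => g (lift ord0 i)])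
     + \sum_(i < n) (-1) ^+ i.+1 *: mapev phi (merge_at g i)
     + (-1) ^+ n.+1 *:
         actr (g ord_max) (mapev phi [ffun i : 'I_n => g (widen_ord (leqnSn n) i)])].

Fact bar_diff_linear n : linear (@bar_diff n).
Proof.
have evP a (u v : Map gT vT n) g :
    mapev (a *: u + v) g = a *: mapev u g + mapev v g.
  by rewrite /mapev; case: pickP => [t _|_]; rewrite ?ffunE // scaler0 addr0.
move=> a u v; apply/ffunP=> t; rewrite !ffunE /= !evP !linearP /=.
under eq_bigr do rewrite evP scalerDr scalerA mulrC -scalerA.
rewrite big_split /= -scaler_sumr !scalerDr.
by rewrite [X in X + _ = _]addrACA [LHS]addrACA.
Qed.

HB.instance Definition _ n :=
  GRing.isLinear.Build k (Map gT vT n) (Map gT vT n.+1) _ (@bar_diff n)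
    (@bar_diff_linear n).

Definition cocycles n : {vspace Map gT vT n} := lker (linfun (@bar_diff n)).

Definition coboundaries n : {vspace Map gT vT n} :=
  match n with
  | 0 => 0%VS
  | m.+1 => limg (linfun (@bar_diff m))
  end.

Definition bar_cohomology n : lmodType k :=
  subquot (cocycles n) (coboundaries n).

End BarComplex.

Section Cohomology.
Variables (k : fieldType) (gT : finGroupType).
Local Notation kG := (group_alg k gT).

Definition HH_actl (g : gT) : {linear kG -> kG} := ga_elt k g \*o idfun.
Definition HH_actr (g : gT) : {linear kG -> kG} := ga_elt k g \o* idfun.

Definition HH n : lmodType k := bar_cohomology HH_actl HH_actr n.

Definition HH_class n (phi : Map gT kG n) (c : HH n) : Prop := is_class phi c.

Definition HH_cup n m (phi : Map gT kG n) (psi : Map gT kG m) : Map gT kG (n + m) :=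
  [ffun t : {ffun 'I_(n + m) -> nontriv gT} =>
     phi [ffun i => t (lshift m i)] * psi [ffun j => t (rshift n j)]].

Definition triv_act (g : gT) : {linear k^o -> k^o} := idfun.

Definition grpH n : lmodType k := bar_cohomology triv_act triv_act n.

Definition grpH_class n (phi : Map gT k^o n) (c : grpH n) : Prop := is_class phi c.

End Cohomology.

Section DirectSum.
Variables (k : fieldType) (I : finType) (V : I -> lmodType k).

Definition dsum := {dffun forall i : I, V i}.

HB.instance Definition _ := Choice.on dsum.

Definition dsum0 : dsum := [ffun i => 0].
Definition dsum_opp (a : dsum) : dsum := [ffun i => - a i].
Definition dsum_add (a b : dsum) : dsum := [ffun i => a i + b i].
Definition dsum_scale (c : k) (a : dsum) : dsum := [ffun i => c *: a i].

Fact dsum_addA : associative dsum_add.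
Proof. by move=> a b c; apply/ffunP=> i; rewrite !ffunE addrA. Qed.
Fact dsum_addC : commutative dsum_add.
Proof. by move=> a b; apply/ffunP=> i; rewrite !ffunE addrC. Qed.
Fact dsum_add0 : left_id dsum0 dsum_add.
Proof. by move=> a; apply/ffunP=> i; rewrite !ffunE add0r. Qed.
Fact dsum_addN : left_inverse dsum0 dsum_opp dsum_add.
Proof. by move=> a; apply/ffunP=> i; rewrite !ffunE addNr. Qed.

HB.instance Definition _ :=
  GRing.isZmodule.Build dsum dsum_addA dsum_addC dsum_add0 dsum_addN.

Fact dsum_scaleA a b v : dsum_scale a (dsum_scale b v) = dsum_scale (a * b) v.
Proof. by apply/ffunP=> i; rewrite !ffunE scalerA. Qed.
Fact dsum_scale1 : left_id 1 dsum_scale.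
Proof. by move=> a; apply/ffunP=> i; rewrite !ffunE scale1r. Qed.
Fact dsum_scaleDr : right_distributive dsum_scale +%R.
Proof. by move=> a u v; apply/ffunP=> i; rewrite !ffunE scalerDr. Qed.
Fact dsum_scaleDl v : {morph dsum_scale^~ v : a b / a + b}.
Proof. by move=> a b; apply/ffunP=> i; rewrite !ffunE scalerDl. Qed.

HB.instance Definition _ := GRing.Zmodule_isLmodule.Build k dsum
  dsum_scaleA dsum_scale1 dsum_scaleDr dsum_scaleDl.

Definition dsum_in (i : I) (v : V i) : dsum := [ffun j => dfwith (fun j => 0 : V j) v j].

End DirectSum.

(* A graded algebra structure on the graded vector space (V n)_n; equalities
   between V (n + (m + p)) and V (n + m + p) are stated in the total space. *)
Record graded_algebra (k : fieldType) (V : nat -> lmodType k) := GradedAlgebra {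
  gmul : forall n m, V n -> V m -> V (n + m)%N;
  gone : V 0%N;
  gmul_linearl : forall n m (b : V m), linear (fun a : V n => gmul a b);
  gmul_linearr : forall n m (a : V n), linear (fun b : V m => gmul a b);
  gmulA : forall n m p (a : V n) (b : V m) (c : V p),
    Tagged (fun d => V d : Type) (gmul a (gmul b c)) =
    Tagged (fun d => V d : Type) (gmul (gmul a b) c);
  gmul1l : forall n (a : V n),
    Tagged (fun d => V d : Type) (gmul gone a) = Tagged (fun d => V d : Type) a;
  gmul1r : forall n (a : V n),
    Tagged (fun d => V d : Type) (gmul a gone) = Tagged (fun d => V d : Type) a
}.

Definition graded_algebra_iso (k : fieldType) (V W : nat -> lmodType k)
    (A : graded_algebra V) (B : graded_algebra W)
    (F : forall n, {linear V n -> W n}) : Prop :=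
  [/\ forall n, bijective (F n),
      forall n m (a : V n) (b : V m), F (n + m)%N (gmul A a b) = gmul B (F n a) (F m b)
    & F 0%N (gone A) = gone B].

Section CentralizerProduct.
Variables (k : fieldType) (gT : finGroupType).
Local Notation kG := (group_alg k gT).

Definition centr (x : gT) : finGroupType := [subg 'C[x]].

(* The degree n part of the direct sum of the H^*(C_G(x), k) for x in X. *)
Definition centrH (X : {set gT}) n : lmodType k :=
  dsum (fun x : {x : gT | x \in X} => grpH k (centr (val x)) n).

Definition ambient (x : gT) n (h : {ffun 'I_n -> nontriv (centr x)}) :
    {ffun 'I_n -> gT} :=
  [ffun l => sgval (val (h l))].

Definition in_Hx (x : gT) n (phi : Map gT kG n) : Prop :=
  forall t : {ffun 'I_n -> nontriv gT},
    (phi t \in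
      <<[seq ga_elt k a | a in ((\prod_(l < n) val (t l)) *: (x ^: [set: gT]))%g]>>)%VS.

Definition hat (x : gT) n (phi : Map gT kG n) : Map (centr x) k^o n :=
  [ffun h : {ffun 'I_n -> nontriv (centr x)} =>
     (mapev phi (ambient h) * ga_elt k (\prod_(l < n) ambient h l)^-1%g) x].

Variable gamma : forall x : gT, 'I_#|(x ^: [set: gT])%g| -> gT.

(* The index s such that gamma_i g lies in C_G(x) gamma_s. *)
Definition coset_step (x : gT) (i : 'I_#|(x ^: [set: gT])%g|) (g : gT) :=
  odflt i [pick s | (gamma i * g)%g \in ('C[x] :* gamma s)%g].

(* s_i^l, with s_i^0 = i. *)
Definition coset_index (x : gT) (i : 'I_#|(x ^: [set: gT])%g|) n
    (g : {ffun 'I_n -> gT}) (l : nat) :=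
  foldl (@coset_step x) i (take l (codom g)).

(* h_{i,l+1} = gamma_{s_i^l} h_{l+1} gamma_{s_i^{l+1}}^-1; subg is only used on
   elements of 'C[x]. *)
Definition coset_part (x : gT) (i : 'I_#|(x ^: [set: gT])%g|) n
    (g : {ffun 'I_n -> gT}) : {ffun 'I_n -> centr x} :=
  [ffun l : 'I_n => subg 'C[x]
     (gamma (coset_index i g l) * g l * (gamma (coset_index i g l.+1))^-1)%g].

Definition cup_at (x y z : gT) n m
    (phi : Map (centr x) k^o n) (psi : Map (centr y) k^o m) :
    Map (centr z) k^o (n + m) :=
  [ffun h : {ffun 'I_(n + m) -> nontriv (centr z)} =>
     let g : {ffun 'I_n -> gT} := [ffun l => ambient h (lshift m l)] in
     let g' : {ffun 'I_m -> gT} := [ffun l => ambient h (rshift n l)] in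
     let p := (\prod_(l < n) g l)%g in
     \sum_(ij : 'I_#|(x ^: [set: gT])%g| * 'I_#|(y ^: [set: gT])%g|
            | (x ^ gamma ij.1 * p * y ^ gamma ij.2 * p^-1)%g == z)
       mapev phi (coset_part ij.1 g) * mapev psi (coset_part ij.2 g')].

End CentralizerProduct.

Arguments centr {gT} x.
Arguments centrH k {gT} X n.
Arguments hat {k gT} x {n} phi.
Arguments in_Hx {k gT} x {n} phi.
Arguments cup_at {k gT} gamma {x y} z {n m} phi psi.

(* Main.v *)
From HB Require Import structures.
Require Import Defs.
From mathcomp Require Import all_boot all_order all_algebra all_fingroup.

Set Implicit Arguments.
Unset Strict Implicit.
Unset Printing Implicit Defensive.

Import GRing.Theory.
Local Open Scope ring_scope.

(* Write cochains homogeneously: phi becomes the function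
     Phi(g_0, ..., g_n) = g_0 phi(g_0^-1 g_1, ..., g_(n-1)^-1 g_n) g_n^-1,
   the differential becomes the alternating sum over faces, and the cup product
   becomes front face times back face.  The coefficients of Phi at x in X
   determine phi; the one at x is invariant under left translation by C_G(x),
   and its restriction to C_G(x) is the hat of phi.  The coset representatives
   give a C_G(x)-equivariant retraction r : G -> C_G(x), g = r(g) gamma_s, and
   pulling cochains back along r is a section of the hat at the level of
   cochains.  The prism homotopy between r and the identity of G shows that a
   cocycle all of whose hats are coboundaries is a coboundary, so the map on
   cohomology is bijective.  The product on the direct sum is the cup product
   transported along it, and evaluating the cup product of the pulled back cochains gives
   the formula, the elements h_(i,l) being the quotients of consecutive values
   of r on gamma_i, gamma_i h_1, gamma_i h_1 h_2, ... *)

(** * Homogeneous cochains and the prism homotopy *)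

Section Simplices.
Variables (k : fieldType) (T : Type) (vT : lmodType k).
Implicit Types (F : (nat -> T) -> vT) (s : nat -> T) (n : nat).

(** An n-simplex is the initial segment s 0, ..., s n of an infinite sequence, so that faces and
    shifts need no casts between ordinals; [dim_ext] says that the rest of the sequence is not
    seen. *)
Definition face i s : nat -> T := fun j => if (j < i)%N then s j else s j.+1.

Definition simp_diff n F s : vT := \sum_(i < n.+2) (-1) ^+ i *: F (face i s).

Definition dim_ext n F :=
  forall s s', (forall i, (i <= n)%N -> s i = s' i) -> F s = F s'.

Definition normalized n F :=
  forall s i, (i < n)%N -> s i = s i.+1 -> F s = 0.

(** When s i = s (i+1), faces i and i+1 agree and carry opposite signs, while every other face still
    contains the repeated vertex. *)
Lemma simp_diff_normalized n F :
  dim_ext n F -> normalized n F -> normalized n.+1 (simp_diff n F).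
Proof.
move=> extF nF s i lt_in eq_s; rewrite /simp_diff.
have lt_i2 : (i < n.+2)%N by apply: ltnW.
rewrite (bigD1 (Ordinal lt_i2)) //= (bigD1 (Ordinal (lt_in : i.+1 < n.+2)%N)) /=; last first.
  by rewrite -val_eqE /= gtn_eqF.
rewrite [X in _ + (_ + X)]big1 ?addr0; last first.
  move=> j; rewrite -!val_eqE /= => /andP[ji ji1].
  have [lt_ij|lt_ji|/eqP] := ltngtP j i; last by rewrite (negPf ji).
    case: i => // i in lt_in eq_s lt_i2 ji ji1 lt_ij *.
    rewrite (nF _ i) ?scaler0 //.
    by rewrite /face !ltnNge (ltnW lt_ij) -ltnS lt_ij.
  have lt_i1j : (i.+1 < j)%N by rewrite ltn_neqAle eq_sym ji1.
  rewrite (nF _ i) ?scaler0 //.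
    by rewrite -ltnS -ltnS (leq_trans _ (ltn_ord j)).
  by rewrite /face lt_i1j lt_ji.
rewrite exprS -scalerA scaleN1r.
have -> : F (face i.+1 s) = F (face i s); last exact: addrN.
apply: extF => j _; rewrite /face ltnS.
by case: ltngtP => // ->.
Qed.

Lemma simp_diffE n F s :
  simp_diff n F s = \sum_(0 <= i < n.+2) (-1) ^+ i *: F (face i s).
Proof. by rewrite big_mkord. Qed.

Lemma simp_diffB n F E s :
  simp_diff n (fun s => F s - E s) s = simp_diff n F s - simp_diff n E s.
Proof. by rewrite /simp_diff -sumrB; apply: eq_bigr => i _; rewrite -scalerBr. Qed.

Section Prism.
Variable r : T -> T.

(** The simplices s_0, ..., s_i, r s_i, ..., r s_n of the usual triangulation of the prism between s
    and its image under [r]. *)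
Definition prism i s : nat -> T := fun j => if (j <= i)%N then s j else r (s j.-1).

Definition prism_op n F s : vT := \sum_(0 <= i < n.+1) (-1) ^+ i *: F (prism i s).

Lemma prism_op_normalized n F :
  normalized n.+1 F -> normalized n (prism_op n F).
Proof.
move=> nF s j lt_jn eq_s; rewrite /prism_op big1 // => i _.
have [le_ji|lt_ij] := leqP j.+1 i.
  rewrite (nF _ j) ?scaler0 //; first exact: ltnW.
  by rewrite /prism le_ji (ltnW le_ji).
rewrite (nF _ j.+1) ?scaler0 // /prism (ltn_geF lt_ij).
by rewrite (ltn_geF (leq_trans lt_ij (leqnSn _))) /= eq_s.
Qed.

Lemma prism_op_ext n F : dim_ext n.+1 F -> dim_ext n (prism_op n F).
Proof.
move=> extF s s' eq_s; apply: eq_big_nat => i /andP[_ lt_in].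
congr (_ *: _); apply: extF => j le_jn; rewrite /prism; case: ifP => [le_ji|_].
  by rewrite eq_s // (leq_trans le_ji).
by rewrite eq_s //; case: j le_jn.
Qed.

Lemma prism_op_map f n F s : dim_ext n.+1 F ->
    (forall u, r (f u) = f (r u)) -> (forall s', F (fun j => f (s' j)) = F s') ->
  prism_op n F (fun j => f (s j)) = prism_op n F s.
Proof.
move=> extF fr fF; apply: eq_bigr => i _; congr (_ *: _); rewrite -[RHS]fF.
by apply: extF => j _; rewrite /prism; case: ifP => // _; rewrite fr.
Qed.

(* The prism decomposition of [0, n] x [0, 1]: adjacent prisms share a face
   (the cochain E i below), so the sum telescopes to the two ends r s and s. *)
Lemma prism_homotopy n F s : dim_ext n.+1 F ->
  (forall s', simp_diff n.+1 F s' = 0) ->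
  F (r \o s) - F s = simp_diff n (prism_op n F) s.
Proof.
move=> extF cF.
pose Q a b := (-1) ^+ (a + b) *: F (prism a (face b s)).
pose E i := F (fun j => if (j < i)%N then s j else r (s j)).
(* This is the cocycle condition at [prism i s]: its faces i and i+1 give [E i] and [E i.+1], the
   lower ones are prisms i-1 over faces of s, the upper ones prisms i over faces of s. *)
have step i : (i <= n.+1)%N ->
  E i - E i.+1 = \sum_(0 <= j < i) Q i.-1 j + \sum_(i.+1 <= b < n.+2) Q i b.
  move=> le_in; have := cF (prism i s); rewrite simp_diffE.
  have le_in2 : (i.+2 <= n.+3)%N by [].
  rewrite (big_cat_nat (n := i)) ?(leq_trans (leqW (leqnSn i)) le_in2) //=.
  rewrite (big_cat_nat (n := i.+2) (m := i)) ?(leqW (leqnSn i)) //=.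
  rewrite big_nat_recl // big_nat1.
  have -> : F (face i (prism i s)) = E i.
    apply: extF => j _; rewrite /face /prism; by case: ltnP => // /ltnW ->.
  have -> : F (face i.+1 (prism i s)) = E i.+1.
    apply: extF => j _; rewrite /face /prism ltnS; by case: ltngtP => // ->.
  move/(congr1 (fun v => (-1) ^+ i *: v)); rewrite scaler0 !scalerDr !scalerA -!exprD.
  rewrite addnS exprS addnn -mul2n exprM sqrrN expr1n expr1n mulN1r scaleN1r scale1r.
  move/eqP; rewrite addrCA addr_eq0 => /eqP ->; rewrite opprD; congr (_ + _).
    rewrite scaler_sumr -sumrN; apply: eq_big_nat => j /andP[_ lt_ji].
    case: i => // i in le_in le_in2 lt_ji *; rewrite /Q scalerA -exprD addSn exprS mulN1r.
    rewrite scaleNr opprK; congr (_ *: _); apply: extF => l _.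
    rewrite /prism /face; have [lt_lj|le_jl] := ltnP l j.
      have le_li : (l <= i)%N by rewrite -ltnS (leq_trans lt_lj) ?leqW.
      by rewrite le_li (leqW le_li).
    rewrite ltnS; have [//|lt_il] := leqP l i.
    by case: l le_jl lt_il => //= l _ lt_il; rewrite ltnNge (leq_trans (lt_ji : j <= i)%N lt_il).
  rewrite scaler_sumr -sumrN [LHS]big_add1 /=; apply: eq_big_nat => j /andP[lt_ij _].
  rewrite /Q scalerA -exprD addnS exprS mulN1r scaleNr opprK; congr (_ *: _).
  apply: extF => l _; rewrite /prism /face ltnS.
  have [le_li|lt_il] := leqP l i.
    by rewrite (leq_trans le_li (ltnW lt_ij)) (leq_ltn_trans le_li).
  case: l lt_il => //= l lt_il.
  by rewrite (ltn_geF (leqW lt_il)); case: ifP.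
have -> : F (r \o s) = E 0%N by [].
have -> : F s = E n.+2 by apply: extF => j le_jn; rewrite ltnS le_jn.
rewrite -opprB -telescope_sumr // -sumrN.
under eq_big_nat => i /andP[_ lt_in] do rewrite opprB step //.
(* The lower sum is empty for i = 0 and the upper one for i = n+1; after shifting the lower index,
   both run over the prisms a <= n and together cover all faces b of s. *)
rewrite big_split /= big_nat_recl // big_geq // add0r.
rewrite [X in _ + X]big_nat_recr //= [X in _ + (_ + X)]big_geq // addr0 -big_split /=.
rewrite simp_diffE /prism_op.
under [RHS]eq_bigr do rewrite scaler_sumr.
rewrite [RHS]exchange_big_nat /=; apply: eq_big_nat => a /andP[_ lt_an].
rewrite -big_cat_nat // 1?ltnW //; apply: eq_bigr => b _.
by rewrite /Q scalerA -exprD addnC.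
Qed.
End Prism.
End Simplices.

(** * Inhomogeneous versus homogeneous cochains *)

Section Mapev.
Variables (k : fieldType) (gT : finGroupType) (vT : vectType k).
Implicit Types (n : nat).

Lemma mapev_nontriv n (phi : Map gT vT n) (t : {ffun 'I_n -> nontriv gT})
    (g : {ffun 'I_n -> gT}) :
  (forall i, g i = val (t i)) -> mapev phi g = phi t.
Proof.
move=> eq_g; rewrite /mapev; case: pickP => [t' /forallP eq_t'|/(_ t)/negP[]].
  congr (phi _); apply/ffunP=> i; apply: val_inj.
  by rewrite -eq_g; exact: (eqP (eq_t' i)).
by apply/forallP=> i; rewrite eq_g.
Qed.

Lemma mapev_degen n (phi : Map gT vT n) (g : {ffun 'I_n -> gT}) i :
  g i = 1%g -> mapev phi g = 0.
Proof.
move=> gi1; rewrite /mapev; case: pickP => // t /forallP/(_ i)/eqP ti.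
by have := valP (t i); rewrite ti gi1 eqxx.
Qed.

Lemma nontrivP n (g : {ffun 'I_n -> gT}) :
  (exists i, g i = 1%g) \/
  exists t : {ffun 'I_n -> nontriv gT}, forall i, g i = val (t i).
Proof.
have [/existsP[i /eqP gi1]|/existsPn g1] := boolP [exists i, g i == 1%g].
  by left; exists i.
by right; exists [ffun i => Sub (g i) (g1 i) : nontriv gT] => i; rewrite ffunE SubK.
Qed.

Lemma mapevD n a (u v : Map gT vT n) g :
  mapev (a *: u + v) g = a *: mapev u g + mapev v g.
Proof.
by rewrite /mapev; case: pickP => [t _|_]; rewrite ?ffunE // scaler0 addr0.
Qed.

End Mapev.

(** * Tuples of group elements and simplices of partial products *)

Section PartialProducts.
Variable gT : finGroupType.

Definition nat_ext n (g : {ffun 'I_n -> gT}) (l : nat) : gT :=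
  if insub l is Some i then g i else 1%g.

Lemma nat_extE n (g : {ffun 'I_n -> gT}) (i : 'I_n) : nat_ext g i = g i.
Proof. by rewrite /nat_ext valK. Qed.

(** With [edges] as inverse, this identifies an n-simplex with its initial vertex y and its tuple of
    consecutive quotients. The padding by 1 in [nat_ext] only affects entries past the last
    vertex. *)
Definition path_simp (y : gT) n (g : {ffun 'I_n -> gT}) (j : nat) : gT :=
  (y * \prod_(0 <= l < j) nat_ext g l)%g.

Lemma path_simp0 y n (g : {ffun 'I_n -> gT}) : path_simp y g 0 = y.
Proof. by rewrite /path_simp big_geq // mulg1. Qed.

Lemma path_simpS y n (g : {ffun 'I_n -> gT}) (i : 'I_n) :
  path_simp y g i.+1 = (path_simp y g i * g i)%g.
Proof. by rewrite /path_simp big_nat_recr //= mulgA nat_extE. Qed.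

Lemma path_simp_last y n (g : {ffun 'I_n -> gT}) :
  path_simp y g n = (y * \prod_(l < n) g l)%g.
Proof.
by rewrite /path_simp big_mkord; congr (_ * _)%g; apply: eq_bigr => i _; rewrite nat_extE.
Qed.

Definition edges n (s : nat -> gT) : {ffun 'I_n -> gT} :=
  [ffun i : 'I_n => ((s i)^-1 * s i.+1)%g].

Lemma edges_path y n (g : {ffun 'I_n -> gT}) : edges n (path_simp y g) = g.
Proof. by apply/ffunP=> i; rewrite ffunE path_simpS mulKg. Qed.

Lemma path_edges n s j : (j <= n)%N -> path_simp (s 0%N) (edges n s) j = s j.
Proof.
elim: j => [|j IHj] le_jn; first exact: path_simp0.
by rewrite (path_simpS _ _ (Ordinal le_jn)) /= IHj ?(ltnW le_jn) // ffunE mulKVg.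
Qed.

Lemma prod_edges n s : (\prod_(l < n) edges n s l = (s 0%N)^-1 * s n)%g.
Proof. by rewrite -[in RHS](path_edges s (leqnn n)) path_simp_last mulKg. Qed.

Lemma edges_ext n s s' : (forall i, (i <= n)%N -> s i = s' i) -> edges n s = edges n s'.
Proof. by move=> eq_s; apply/ffunP=> i; rewrite !ffunE !eq_s // ltnW. Qed.

End PartialProducts.

Section Homog.
Variables (k : fieldType) (gT : finGroupType) (vT : vectType k).
Variables (actl actr : gT -> {linear vT -> vT}).
Hypothesis actl1 : forall v, actl 1%g v = v.
Hypothesis actlM : forall g h v, actl (g * h)%g v = actl g (actl h v).
Hypothesis actr1 : forall v, actr 1%g v = v.
Hypothesis actrM : forall g h v, actr (g * h)%g v = actr h (actr g v).
Hypothesis actlr : forall g h v, actl g (actr h v) = actr h (actl g v).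
Implicit Types (n : nat) (s : nat -> gT).

Definition homog n (phi : Map gT vT n) s : vT :=
  actl (s 0%N) (actr (s n)^-1%g (mapev phi (edges n s))).

Lemma homog_ext n (phi : Map gT vT n) : dim_ext n (homog phi).
Proof. by move=> s s' eq_s; rewrite /homog !eq_s // (edges_ext eq_s). Qed.

Lemma homog_normalized n (phi : Map gT vT n) : normalized n (homog phi).
Proof.
move=> s i lt_in eq_s; rewrite /homog (@mapev_degen _ _ _ _ _ _ (Ordinal lt_in)) ?linear0 //.
by rewrite ffunE /= eq_s mulVg.
Qed.

Lemma homog_linear n a (u v : Map gT vT n) s :
  homog (a *: u + v) s = a *: homog u s + homog v s.
Proof. by rewrite /homog mapevD !linearP. Qed.

Lemma homog0 n s : homog (0 : Map gT vT n) s = 0.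
Proof.
by rewrite /homog /mapev; case: pickP => [t|] _; rewrite ?ffunE !linear0.
Qed.

Lemma homogZ n a (u : Map gT vT n) s : homog (a *: u) s = a *: homog u s.
Proof. by rewrite -[a *: u]addr0 homog_linear homog0 addr0. Qed.

(** Deleting an inner vertex multiplies two consecutive edges; deleting an end vertex drops an edge,
    whose action is absorbed by the change of end vertex. Simplices with a trivial edge are treated
    first: there both sides vanish by normalization. *)
Lemma homog_diff n (phi : Map gT vT n) s :
  homog (bar_diff actl actr phi) s = simp_diff n (homog phi) s.
Proof.
have [[i]|[t eq_t]] := nontrivP (edges n.+1 s).
  rewrite ffunE => /eqP; rewrite -eq_mulVg1 => /eqP eq_s.
  rewrite (homog_normalized _ (ltn_ord i) eq_s).
  by rewrite (simp_diff_normalized (@homog_ext _ _) (@homog_normalized _ _) (ltn_ord i)).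
rewrite /homog (mapev_nontriv _ eq_t) ffunE /=.
have -> : [ffun i => val (t i)] = edges n.+1 s.
  by apply/ffunP=> i; rewrite eq_t ffunE.
rewrite 2!linearD /= 2!linearD /= /simp_diff.
rewrite big_ord_recl big_ord_recr /= expr0 scale1r addrA.
congr (_ + _ + _).
- rewrite -[in LHS]actlr !ffunE /= -actlM mulKVg; congr (actl _ (actr _ (mapev _ _))).
  by apply/ffunP=> i; rewrite !ffunE.
- rewrite !linear_sum /=; apply: eq_bigr => i _; rewrite !linearZ /=.
  congr (_ *: _); rewrite /face /= ltnS leqNgt ltn_ord /=.
  congr (actl _ (actr _ (mapev _ _))); apply/ffunP=> j; rewrite !ffunE /= !ltnS.
  have [lt_ji|lt_ij|/val_inj->] := ltngtP j i; rewrite ?eqxx ?leqnn ?ltnn //=.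
  + by rewrite ifN // -val_eqE gtn_eqF.
  + by rewrite -mulgA mulKVg.
- rewrite !linearZ /=; congr (_ *: _).
  rewrite !ffunE /= -actrM -mulgA mulgV mulg1.
  rewrite /face ltnS leq0n /= ltnSn; congr (actl _ (actr _ (mapev _ _))).
  by apply/ffunP=> j; have lt_jn := ltn_ord j; rewrite !ffunE /= !ltnS lt_jn (ltnW lt_jn).
Qed.

(** Recovers a cochain from its homogeneous form: on the path starting at 1 the left action is
    trivial, and the outer right action undoes that of the last vertex. *)
Lemma homog_path n (phi : Map gT vT n) (t : {ffun 'I_n -> nontriv gT}) :
  let g := [ffun i => val (t i)] in
  actr (\prod_(l < n) g l)%g (homog phi (path_simp 1 g)) = phi t.
Proof.
move=> g; rewrite /homog path_simp0 path_simp_last mul1g edges_path actl1 -actrM mulVg actr1.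
by apply: mapev_nontriv => i; rewrite ffunE.
Qed.

Lemma homog_inj n (phi psi : Map gT vT n) :
  (forall s, homog phi s = homog psi s) -> phi = psi.
Proof. by move=> eq_h; apply/ffunP=> t; rewrite -!homog_path eq_h. Qed.

Lemma cocyclesP n (phi : Map gT vT n) :
  reflect (bar_diff actl actr phi = 0) (phi \in cocycles actl actr n).
Proof. by rewrite memv_ker lfunE; exact: eqP. Qed.

Lemma cocycle_homog n (phi : Map gT vT n) s :
  phi \in cocycles actl actr n -> simp_diff n (homog phi) s = 0.
Proof. by move=> /cocyclesP d0; rewrite -homog_diff d0 homog0. Qed.

Lemma coboundary_diff n (psi : Map gT vT n) :
  bar_diff actl actr psi \in coboundaries actl actr n.+1.
Proof. by rewrite /= -[bar_diff _ _ _]lfunE memv_img ?memvf. Qed.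

(* The equation N = n.+1 is kept propositional because n + m.+1 and (n + m).+1
   are not convertible. *)
Lemma coboundary_homog N n (phi : Map gT vT N) (psi : Map gT vT n) :
    N = n.+1 -> (forall s, homog phi s = simp_diff n (homog psi) s) ->
  phi \in coboundaries actl actr N.
Proof.
move=> eqN; subst N => eq_h.
rewrite (_ : phi = bar_diff actl actr psi) ?coboundary_diff //.
by apply: homog_inj => s; rewrite homog_diff.
Qed.

Lemma coboundaryP n (phi : Map gT vT n.+1) :
  phi \in coboundaries actl actr n.+1 -> exists psi, phi = bar_diff actl actr psi.
Proof. by case/memv_imgP=> psi _; rewrite lfunE; exists psi. Qed.

End Homog.

(** * Cohomology classes *)

Section SubquotientClasses.
Local Open Scope quotient_scope.
Variables (k : fieldType) (vT : vectType k) (Z B : {vspace vT}).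

(** The projection [vsproj] makes this a linear map on all of [vT]; it is the class of v only for v
    in [Z]. *)
Definition sq_class (v : vT) : subquot Z B := \pi_(subquot Z B) (vsproj Z v).
Definition sq_rep (c : subquot Z B) : vT := vsval (generic_quotient.repr c).

Lemma sq_rep_in c : sq_rep c \in Z.
Proof. exact: subvsP. Qed.

Lemma sq_repK : cancel sq_rep sq_class.
Proof. by move=> c; rewrite /sq_class /sq_rep vsvalK reprK. Qed.

Lemma sq_class_linear : linear sq_class.
Proof.
move=> a u v; rewrite /sq_class linearP raddfD; congr (_ + _).
by rewrite /= -subq_piZ.
Qed.

HB.instance Definition _ := GRing.isLinear.Build k vT (subquot Z B) _ sq_class
  sq_class_linear.

Lemma sq_class_eq u v : u \in Z -> v \in Z -> (sq_class u == sq_class v) = (u - v \in B).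
Proof.
move=> Zu Zv; have := Quotient.idealrBE (subq_ker B : zmodClosed _) (vsproj Z u) (vsproj Z v).
rewrite -linearB unfold_in /subq_ker vsprojK ?(rpredB Zu Zv) // => ->.
Qed.

Lemma is_classP v (c : subquot Z B) : is_class v c <-> v \in Z /\ c = sq_class v.
Proof.
split=> [[z [<- ->]]|[Zv ->]]; first by rewrite /sq_class vsvalK subvsP.
by exists (vsproj Z v); rewrite vsprojK.
Qed.

End SubquotientClasses.

(** * The Hochschild cohomology algebra *)

Lemma eq_simp_diff (k : fieldType) (T : Type) (vT : lmodType k) n
    (F E : (nat -> T) -> vT) s :
  (forall s, F s = E s) -> simp_diff n F s = simp_diff n E s.
Proof. by move=> eqFE; apply: eq_bigr => i _; rewrite eqFE. Qed.

(** Leibniz rule for front face times back face. The right side has two terms more than the left,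
    face n+1 of the front and face 0 of the back; they are opposite multiples of F s * E' and
    cancel. *)
Lemma simp_diffM (k : fieldType) (T : Type) (R : algType k) n m
    (F E : (nat -> T) -> R) (s : nat -> T) :
    dim_ext n F -> dim_ext m E ->
  simp_diff (n + m) (fun s => F s * E (fun j => s (n + j)%N)) s =
    simp_diff n F s * E (fun j => s (n.+1 + j)%N)
    + (-1) ^+ n *: (F s * simp_diff m E (fun j => s (n + j)%N)).
Proof.
move=> extF extE; rewrite simp_diffE (big_cat_nat (n := n.+1)) //=; last first.
  by rewrite ltnS leqW ?leq_addr.
set E' := E (fun j => s (n.+1 + j)%N).
have -> : \sum_(0 <= i < n.+1) (-1) ^+ i *: (F (face i s) * E (fun j => face i s (n + j)%N))
    = (simp_diff n F s + (-1) ^+ n *: F s) * E'.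
  rewrite simp_diffE [in RHS]big_nat_recr //= (extF (face n.+1 s) s); last first.
    by move=> i le_in; rewrite /face ltnS le_in.
  rewrite exprS -scalerA scaleN1r addrNK mulr_suml.
  apply: eq_big_nat => i /andP[_ lt_in]; rewrite -scalerAl; congr (_ *: (_ * _)).
  by apply: extE => j _; rewrite /face ltnNge (leq_trans (lt_in : i <= n)%N (leq_addr _ _)).
have -> : \sum_(n.+1 <= i < (n + m).+2)
      (-1) ^+ i *: (F (face i s) * E (fun j => face i s (n + j)%N))
    = (-1) ^+ n *: (F s * (simp_diff m E (fun j => s (n + j)%N) - E')).
  rewrite simp_diffE [in RHS]big_nat_recl //= expr0 scale1r.
  rewrite (extE (face 0 _) (fun j => s (n.+1 + j)%N)); last first.
    by move=> i _; rewrite /face /= addnS.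
  rewrite addrAC subrr add0r mulr_sumr scaler_sumr.
  rewrite -[in LHS](add0n n.+1) big_addn subSS -addnS addKn.
  apply: eq_big_nat => i _; rewrite -scalerAr scalerA -exprD addnC addSnnS.
  congr (_ *: (_ * _)).
    by apply: extF => j le_jn; rewrite /face addnS ltnS (leq_trans le_jn) ?leq_addr.
  by apply: extE => j _; rewrite /face ltn_add2l addnS.
by rewrite mulrDl mulrBr scalerBr -scalerAl -addrA [_ *: _ + (_ - _)]addrC subrK.
Qed.

Section GroupAlgebraTheory.
Variables (k : fieldType) (gT : finGroupType).
Local Notation kG := (group_alg k gT).

Lemma ga_eltMl g (a : kG) x : (ga_elt k g * a) x = a (g^-1 * x)%g.
Proof.
rewrite ffunE (bigD1 g) //= ffunE eqxx mul1r big1 ?addr0 // => h /negPf hg.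
by rewrite ffunE hg mul0r.
Qed.

Lemma ga_eltMr g (a : kG) x : (a * ga_elt k g) x = a (x * g^-1)%g.
Proof.
rewrite ffunE (bigD1 (x * g^-1)%g) //= ffunE invMg invgK mulgKV eqxx mulr1.
rewrite big1 ?addr0 // => h hx.
rewrite ffunE [_ == _](_ : _ = false) ?mulr0 //; apply: contraNF hx => /eqP <-.
by rewrite invMg invgK mulKVg.
Qed.

Lemma ga_eltM (g h : gT) : ga_elt k g * ga_elt k h = ga_elt k (g * h)%g.
Proof.
by apply/ffunP=> x; rewrite ga_eltMl !ffunE (can2_eq (mulKVg g) (mulKg g)).
Qed.

Lemma HH_actl1 v : HH_actl k 1%g v = v :> kG.
Proof. exact: mul1r. Qed.
Lemma HH_actlM g h v : HH_actl k (g * h)%g v = HH_actl k g (HH_actl k h v) :> kG.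
Proof. by rewrite /= -ga_eltM -mulrA. Qed.
Lemma HH_actr1 v : HH_actr k 1%g v = v :> kG.
Proof. exact: mulr1. Qed.
Lemma HH_actrM g h v : HH_actr k (g * h)%g v = HH_actr k h (HH_actr k g v) :> kG.
Proof. by rewrite /= -ga_eltM mulrA. Qed.
Lemma HH_actlr g h v : HH_actl k g (HH_actr k h v) = HH_actr k h (HH_actl k g v) :> kG.
Proof. by rewrite /= mulrA. Qed.

Local Notation homHH := (homog (HH_actl k (gT := gT)) (HH_actr k (gT := gT))).

Lemma homHH_apply n (phi : Map gT kG n) s x :
  homHH phi s x = mapev phi (edges n s) ((s 0%N)^-1 * x * s n)%g.
Proof. by rewrite /homog /= ga_eltMl ga_eltMr invgK. Qed.

Lemma mapev_cup n m (phi : Map gT kG n) (psi : Map gT kG m) (g : {ffun 'I_(n + m) -> gT}) :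
  mapev (HH_cup phi psi) g =
    mapev phi [ffun i => g (lshift m i)] * mapev psi [ffun j => g (rshift n j)].
Proof.
have [[i gi1]|[t eq_t]] := nontrivP g.
  rewrite (mapev_degen _ gi1); case: (split_ordP i) gi1 => j -> gj1.
    by rewrite (@mapev_degen _ _ _ _ phi _ j) ?mul0r // ffunE.
  by rewrite (@mapev_degen _ _ _ _ psi _ j) ?mulr0 // ffunE.
rewrite (mapev_nontriv _ eq_t) ffunE; congr (_ * _);
  by symmetry; apply: mapev_nontriv => i; rewrite !ffunE eq_t.
Qed.

(** The factor (s n)^-1 closing the first homogeneous cochain cancels the factor s n opening the
    second. *)
Lemma homHH_cup n m (phi : Map gT kG n) (psi : Map gT kG m) s :
  homHH (HH_cup phi psi) s = homHH phi s * homHH psi (fun j => s (n + j)%N).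
Proof.
rewrite /homog /= mapev_cup addn0 !mulrA; congr (_ * _).
rewrite -[_ * _ * ga_elt k (s n)]mulrA ga_eltM mulVg mulr1 -!mulrA; congr (_ * (_ * _)).
  by congr (mapev _ _); apply/ffunP=> i; rewrite !ffunE.
by congr (mapev _ _); apply/ffunP=> i; rewrite !ffunE /= addnS.
Qed.

Lemma simp_diff_cup n m (phi : Map gT kG n) (psi : Map gT kG m) s :
  simp_diff (n + m) (homHH (HH_cup phi psi)) s =
    simp_diff n (homHH phi) s * homHH psi (fun j => s (n.+1 + j)%N)
    + (-1) ^+ n *: (homHH phi s * simp_diff m (homHH psi) (fun j => s (n + j)%N)).
Proof.
rewrite -simp_diffM; [|exact: homog_ext..].
by apply: eq_simp_diff => s'; rewrite homHH_cup.
Qed.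

Lemma HH_cup_linearl n m (psi : Map gT kG m) :
  linear (fun phi : Map gT kG n => HH_cup phi psi).
Proof. by move=> a u v; apply/ffunP=> t; rewrite !ffunE mulrDl scalerAl. Qed.

Lemma HH_cup_linearr n m (phi : Map gT kG n) :
  linear (fun psi : Map gT kG m => HH_cup phi psi).
Proof. by move=> a u v; apply/ffunP=> t; rewrite !ffunE mulrDr scalerAr. Qed.

Local Notation HHZ := (cocycles (HH_actl k (gT := gT)) (HH_actr k (gT := gT))).
Local Notation HHB := (coboundaries (HH_actl k (gT := gT)) (HH_actr k (gT := gT))).

Let hom_diff := homog_diff HH_actlM HH_actrM HH_actlr.
Let hom_inj := homog_inj HH_actl1 HH_actr1 HH_actrM.
Let hom_cocycle n phi s := @cocycle_homog k gT kG _ _ HH_actlM HH_actrM HH_actlr n phi s.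
Let hom_cob N n phi psi := @coboundary_homog k gT kG _ _ HH_actl1 HH_actlM
   HH_actr1 HH_actrM HH_actlr N n phi psi.

Lemma HH_cup_cocycle n m (phi : Map gT kG n) (psi : Map gT kG m) :
  phi \in HHZ n -> psi \in HHZ m -> HH_cup phi psi \in HHZ (n + m).
Proof.
move=> Zphi Zpsi; apply/cocyclesP; apply: hom_inj => s.
by rewrite hom_diff homog0 simp_diff_cup !hom_cocycle // mul0r mulr0 scaler0 addr0.
Qed.

Lemma HH_cup_coboundaryl n m (phi : Map gT kG n) (psi : Map gT kG m) :
  phi \in HHB n -> psi \in HHZ m -> HH_cup phi psi \in HHB (n + m).
Proof.
case: n phi => [|n] phi.
  rewrite memv0 => /eqP -> _; rewrite (_ : HH_cup _ _ = 0) ?mem0v //.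
  by apply/ffunP=> t; rewrite !ffunE mul0r.
case/coboundaryP=> alpha -> Zpsi; apply: (hom_cob (psi := HH_cup alpha psi)) => // s.
by rewrite homHH_cup hom_diff simp_diff_cup (hom_cocycle _ Zpsi) mulr0 scaler0 addr0.
Qed.

Lemma HH_cup_coboundaryr n m (phi : Map gT kG n) (psi : Map gT kG m) :
  phi \in HHZ n -> psi \in HHB m -> HH_cup phi psi \in HHB (n + m).
Proof.
case: m psi => [|m] psi Zphi.
  rewrite memv0 => /eqP ->; rewrite (_ : HH_cup _ _ = 0) ?mem0v //.
  by apply/ffunP=> t; rewrite !ffunE mulr0.
case/coboundaryP=> beta ->.
(* The sign compensates the one that the Leibniz rule gives to the second factor. *)
apply: (hom_cob (psi := (-1) ^+ n *: HH_cup phi beta)) => [|s]; first exact: addnS.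
rewrite homHH_cup hom_diff -[RHS]hom_diff linearZ /= homogZ hom_diff simp_diff_cup.
rewrite (hom_cocycle _ Zphi) mul0r add0r.
by rewrite scalerA -exprMn mulrNN mulr1 expr1n scale1r.
Qed.

End GroupAlgebraTheory.

(** * The cup product on Hochschild classes *)

Section HochschildAlgebra.
Variables (k : fieldType) (gT : finGroupType).
Local Notation kG := (group_alg k gT).
Local Notation HHl := (HH_actl k (gT := gT)).
Local Notation HHr := (HH_actr k (gT := gT)).
Local Notation HHZ := (cocycles HHl HHr).
Local Notation HHB := (coboundaries HHl HHr).
Local Notation homHH := (homog HHl HHr).

Definition HH_cls n (phi : Map gT kG n) : HH k gT n := sq_class (HHZ n) (HHB n) phi.
Definition HH_rep n (a : HH k gT n) : Map gT kG n := sq_rep a.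

Lemma HH_cls_linear n : linear (@HH_cls n).
Proof. exact: sq_class_linear. Qed.

Lemma HH_rep_cocycle n (a : HH k gT n) : HH_rep a \in HHZ n.
Proof. exact: sq_rep_in. Qed.

Lemma HH_repK n : cancel (@HH_rep n) (@HH_cls n).
Proof. exact: sq_repK. Qed.

Lemma HH_cls_eq n (phi psi : Map gT kG n) :
  phi \in HHZ n -> psi \in HHZ n -> (HH_cls phi == HH_cls psi) = (phi - psi \in HHB n).
Proof. exact: sq_class_eq. Qed.

Lemma HH_classP n (phi : Map gT kG n) c :
  HH_class phi c <-> phi \in HHZ n /\ c = HH_cls phi.
Proof. exact: is_classP. Qed.

Definition HH_mul n m (a : HH k gT n) (b : HH k gT m) : HH k gT (n + m) :=
  HH_cls (HH_cup (HH_rep a) (HH_rep b)).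

(** The factors are replaced by cohomologous cocycles one at a time, and each replacement changes
    the cup product by a coboundary. *)
Lemma HH_mul_cls n m (phi : Map gT kG n) (psi : Map gT kG m) :
  phi \in HHZ n -> psi \in HHZ m ->
  HH_mul (HH_cls phi) (HH_cls psi) = HH_cls (HH_cup phi psi).
Proof.
move=> Zphi Zpsi; apply/eqP; rewrite HH_cls_eq ?HH_cup_cocycle ?HH_rep_cocycle //.
set phi' := HH_rep _; set psi' := HH_rep _.
have Bphi : phi' - phi \in HHB n by rewrite -HH_cls_eq ?HH_rep_cocycle // HH_repK.
have Bpsi : psi' - psi \in HHB m by rewrite -HH_cls_eq ?HH_rep_cocycle // HH_repK.
have -> : HH_cup phi' psi' - HH_cup phi psi =
    HH_cup (phi' - phi) psi' + HH_cup phi (psi' - psi).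
  by apply/ffunP=> t; rewrite !ffunE mulrBl mulrBr addrA subrK.
apply: rpredD; last exact: HH_cup_coboundaryr.
by apply: HH_cup_coboundaryl => //; exact: HH_rep_cocycle.
Qed.

Lemma HH_mul_linearl n m (b : HH k gT m) : linear (fun a : HH k gT n => HH_mul a b).
Proof.
move=> c u v; rewrite -[u]HH_repK -[v]HH_repK -[b]HH_repK -HH_cls_linear.
rewrite !HH_mul_cls ?HH_rep_cocycle ?rpredD ?rpredZ ?HH_rep_cocycle //.
by rewrite HH_cup_linearl HH_cls_linear.
Qed.

Lemma HH_mul_linearr n m (a : HH k gT n) : linear (fun b : HH k gT m => HH_mul a b).
Proof.
move=> c u v; rewrite -[u]HH_repK -[v]HH_repK -[a]HH_repK -HH_cls_linear.
rewrite !HH_mul_cls ?HH_rep_cocycle ?rpredD ?rpredZ ?HH_rep_cocycle //.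
by rewrite HH_cup_linearr HH_cls_linear.
Qed.

(** Homogeneous cochains have the same type in all degrees, so cochains in propositionally equal
    degrees can be compared through them without a cast. *)
Lemma Tagged_HH_cls N N' (phi : Map gT kG N) (psi : Map gT kG N') :
    N = N' -> (forall s, homHH phi s = homHH psi s) ->
  Tagged (fun d => HH k gT d : Type) (HH_cls phi) =
  Tagged (fun d => HH k gT d : Type) (HH_cls psi).
Proof.
move=> eqN; subst N' => eq_h.
by rewrite (homog_inj (@HH_actl1 _ _) (@HH_actr1 _ _) (@HH_actrM _ _) eq_h).
Qed.

Lemma HH_mulA n m p (a : HH k gT n) (b : HH k gT m) (c : HH k gT p) :
  Tagged (fun d => HH k gT d : Type) (HH_mul a (HH_mul b c)) =
  Tagged (fun d => HH k gT d : Type) (HH_mul (HH_mul a b) c).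
Proof.
rewrite -[a]HH_repK -[b]HH_repK -[c]HH_repK.
rewrite !HH_mul_cls ?HH_cup_cocycle ?HH_rep_cocycle //.
apply: Tagged_HH_cls => [|s]; first exact: addnA.
by rewrite !homHH_cup mulrA; congr (_ * _); apply: homog_ext => i _; rewrite addnA.
Qed.

Definition HH_one_cochain : Map gT kG 0 := [ffun _ => 1].

Lemma homHH_one s : homHH HH_one_cochain s = 1.
Proof.
rewrite /homog; have [[[]] //|[t eq_t]] := nontrivP (edges 0 s).
by rewrite (mapev_nontriv _ eq_t) ffunE /= mul1r ga_eltM mulgV.
Qed.

Lemma HH_one_cocycle : HH_one_cochain \in HHZ 0.
Proof.
apply/cocyclesP; apply: (homog_inj (@HH_actl1 _ _) (@HH_actr1 _ _) (@HH_actrM _ _)) => s.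
rewrite homog_diff; [|exact: HH_actlM|exact: HH_actrM|exact: HH_actlr].
rewrite homog0 /simp_diff !big_ord_recl big_ord0 !homHH_one.
by rewrite expr0 expr1 scale1r scaleN1r addr0 subrr.
Qed.

Definition HH_one : HH k gT 0 := HH_cls HH_one_cochain.

Lemma HH_mul1l n (a : HH k gT n) :
  Tagged (fun d => HH k gT d : Type) (HH_mul HH_one a) = Tagged (fun d => HH k gT d : Type) a.
Proof.
rewrite -[a]HH_repK HH_mul_cls ?HH_one_cocycle ?HH_rep_cocycle //.
by apply: Tagged_HH_cls => // s; rewrite homHH_cup homHH_one mul1r.
Qed.

Lemma HH_mul1r n (a : HH k gT n) :
  Tagged (fun d => HH k gT d : Type) (HH_mul a HH_one) = Tagged (fun d => HH k gT d : Type) a.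
Proof.
rewrite -[a]HH_repK HH_mul_cls ?HH_one_cocycle ?HH_rep_cocycle //.
by apply: Tagged_HH_cls => [|s]; rewrite ?addn0 // homHH_cup homHH_one mulr1.
Qed.

Definition HH_algebra : graded_algebra (HH k gT) :=
  GradedAlgebra HH_mul_linearl HH_mul_linearr HH_mulA HH_mul1l HH_mul1r.

End HochschildAlgebra.

(** * Transport of a graded algebra structure along linear isomorphisms *)

Section Transport.
Variables (k : fieldType) (V W : nat -> lmodType k) (A : graded_algebra V).
Variables (F : forall n, {linear V n -> W n}) (E : forall n, {linear W n -> V n}).
Hypotheses (FK : forall n, cancel (F n) (E n)) (EK : forall n, cancel (E n) (F n)).

(** Associativity and the unit laws are inherited from [A], so none of them has to be verified on
    the explicit cochain formula. *)
Definition transport_mul n m (a : W n) (b : W m) : W (n + m)%N :=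
  F (n + m)%N (gmul A (E n a) (E m b)).

Lemma transport_mul_linearl n m (b : W m) : linear (fun a : W n => transport_mul a b).
Proof. by move=> c u v; rewrite /transport_mul linearP gmul_linearl linearP. Qed.

Lemma transport_mul_linearr n m (a : W n) : linear (fun b : W m => transport_mul a b).
Proof. by move=> c u v; rewrite /transport_mul linearP gmul_linearr linearP. Qed.

(** Applies [F] inside the total space, where the axioms relating different degrees are stated. *)
Let tagF (u : {d & V d : Type}) := Tagged (fun d => W d : Type) (F _ (tagged u)).

Lemma transport_mulA n m p (a : W n) (b : W m) (c : W p) :
  Tagged (fun d => W d : Type) (transport_mul a (transport_mul b c)) =
  Tagged (fun d => W d : Type) (transport_mul (transport_mul a b) c).
Proof. by rewrite /transport_mul !FK; exact: (congr1 tagF (gmulA A _ _ _)). Qed.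

Lemma transport_mul1l n (a : W n) :
  Tagged (fun d => W d : Type) (transport_mul (F 0%N (gone A)) a) =
  Tagged (fun d => W d : Type) a.
Proof. by rewrite /transport_mul FK -[in RHS](EK a); exact: (congr1 tagF (gmul1l A _)). Qed.

Lemma transport_mul1r n (a : W n) :
  Tagged (fun d => W d : Type) (transport_mul a (F 0%N (gone A))) =
  Tagged (fun d => W d : Type) a.
Proof. by rewrite /transport_mul FK -[in RHS](EK a); exact: (congr1 tagF (gmul1r A _)). Qed.

Definition transport_algebra : graded_algebra W :=
  GradedAlgebra transport_mul_linearl transport_mul_linearr transport_mulA
    transport_mul1l transport_mul1r.

Lemma transport_iso : graded_algebra_iso A transport_algebra F.
Proof.
split=> // [n|n m a b]; first by exists (E n); [exact: FK|exact: EK].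
by rewrite /= /transport_mul !FK.
Qed.

End Transport.

(** * Restriction to a centralizer *)

Lemma simp_diff_map (k : fieldType) (T U : Type) (vT : lmodType k) (f : T -> U) n
    (F : (nat -> U) -> vT) (s : nat -> T) :
  dim_ext n F -> simp_diff n F (f \o s) = simp_diff n (fun s => F (f \o s)) s.
Proof.
move=> extF; apply: eq_bigr => i _; congr (_ *: _); apply: extF => j _.
by rewrite /face /=; case: ifP.
Qed.

Section GroupCohomology.
Variables (k : fieldType) (gT : finGroupType).
Local Notation homC := (homog (@triv_act k gT) (@triv_act k gT)).

Lemma homC_apply n (psi : Map gT k^o n) s : homC psi s = mapev psi (edges n s).
Proof. by []. Qed.

Lemma homC_mull n (psi : Map gT k^o n) c s : homC psi (fun j => c * s j)%g = homC psi s.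
Proof.
rewrite !homC_apply; congr (mapev _ _); apply/ffunP=> i.
by rewrite !ffunE invMg -mulgA mulKg.
Qed.

Lemma homC_diff n (psi : Map gT k^o n) s :
  homC (bar_diff (@triv_act k gT) (@triv_act k gT) psi) s = simp_diff n (homC psi) s.
Proof. exact: homog_diff. Qed.

Lemma homC_inj n (phi psi : Map gT k^o n) :
  (forall s, homC phi s = homC psi s) -> phi = psi.
Proof. exact: homog_inj. Qed.

End GroupCohomology.

Section HochschildConj.
Variables (k : fieldType) (gT : finGroupType).
Local Notation kG := (group_alg k gT).
Local Notation homHH := (homog (HH_actl k (gT := gT)) (HH_actr k (gT := gT))).

(** Conjugating the group element at which a coefficient is read amounts to translating the simplex.
    Hence coefficients at class representatives suffice, and the one at x is invariant under
    C_G(x). *)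
Lemma homHH_conj n (phi : Map gT kG n) s x y :
  homHH phi s (x ^ y)%g = homHH phi (fun j => y * s j)%g x.
Proof.
rewrite !homHH_apply; have -> : edges n (fun j => y * s j)%g = edges n s.
  by apply/ffunP=> i; rewrite !ffunE invMg -mulgA mulKg.
by rewrite invMg conjgE !mulgA.
Qed.

Lemma homHH_diff n (phi : Map gT kG n) s :
  homHH (bar_diff (HH_actl k (gT := gT)) (HH_actr k (gT := gT)) phi) s = simp_diff n (homHH phi) s.
Proof. exact: homog_diff (@HH_actlM _ _) (@HH_actrM _ _) (@HH_actlr _ _) _ _ _. Qed.

Lemma simp_diff_coef n (F : (nat -> gT) -> kG) s x :
  simp_diff n F s x = simp_diff n (fun s => F s x : k^o) s.
Proof. by rewrite /simp_diff sum_ffunE; apply: eq_bigr => i _; rewrite ffunE. Qed.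

Lemma homHH_coef_ext n (phi : Map gT kG n) x :
  dim_ext n (fun s => homHH phi s x : k^o).
Proof. by move=> s s' eq_s; rewrite (homog_ext _ _ _ eq_s). Qed.

Lemma homHH_coef_normalized n (phi : Map gT kG n) x :
  normalized n (fun s => homHH phi s x : k^o).
Proof. by move=> s i lt_in eq_s; rewrite (homog_normalized _ _ _ lt_in eq_s) ffunE. Qed.

Lemma homHH_mull n (phi : Map gT kG n) x c s : c \in 'C[x]%g ->
  homHH phi (fun j => c * s j)%g x = homHH phi s x.
Proof.
move=> /cent1P cx; rewrite -homHH_conj; congr (homHH phi s _).
by rewrite conjgE -cx mulKg.
Qed.

Variable x : gT.
Local Notation homC := (homog (@triv_act k (centr x)) (@triv_act k (centr x))).

Lemma hat_homog n (phi : Map gT kG n) (c : nat -> centr x) :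
  homC (hat x phi) c = homHH phi (fun j => sgval (c j)) x.
Proof.
have eq_e i : edges n (fun j => sgval (c j)) i = sgval (edges n c i).
  by rewrite !ffunE.
rewrite homC_apply homHH_apply; have [[i ci1]|[t eq_t]] := nontrivP (edges n c).
  rewrite (mapev_degen _ ci1) (@mapev_degen _ _ _ _ _ _ i); first by rewrite ffunE.
  by rewrite eq_e ci1.
rewrite (mapev_nontriv _ eq_t) ffunE ga_eltMr invgK.
have -> : ambient t = edges n (fun j => sgval (c j)).
  by apply/ffunP=> i; rewrite eq_e eq_t ffunE.
(* The edges multiply to c_0^-1 c_n, so the hat reads a coefficient at x c_0^-1 c_n and the
   homogeneous cochain at c_0^-1 x c_n; these agree because c_0 centralizes x. *)
have cx : commute x (sgval (c 0%N))^-1 by apply/commuteV/commute_sym/cent1P; exact: subgP.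
by rewrite prod_edges !mulgA cx.
Qed.

Lemma hat_diff n (phi : Map gT kG n) :
  hat x (bar_diff (HH_actl k (gT := gT)) (HH_actr k (gT := gT)) phi) =
  bar_diff (@triv_act k (centr x)) (@triv_act k (centr x)) (hat x phi).
Proof.
apply: homC_inj => c; rewrite hat_homog homHH_diff homC_diff simp_diff_coef.
have := simp_diff_map (fun u : centr x => sgval u) c (homHH_coef_ext phi x).
rewrite /comp => ->; by apply: eq_simp_diff => s; rewrite hat_homog.
Qed.

Lemma hat_linear n : linear (hat x (n := n) : Map gT kG n -> _).
Proof.
by move=> a u v; apply: homC_inj => c; rewrite homog_linear !hat_homog homog_linear !ffunE.
Qed.

End HochschildConj.

(** * The inverse isomorphism and the product formula *)

Section Shapiro.
Variables (k : fieldType) (gT : finGroupType) (X : {set gT}).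
Variable gamma : forall x : gT, 'I_#|(x ^: [set: gT])%g| -> gT.
Arguments gamma : clear implicits.
Hypothesis X_reps : is_transversal X (classes [set: gT]) [set: gT].
Hypothesis gamma_1 : forall x, x \in X ->
  forall i : 'I_#|(x ^: [set: gT])%g|, i = 0%N :> nat -> gamma x i = 1%g.
Hypothesis gamma_cosets : forall x, x \in X ->
  forall g, exists! i, g \in ('C[x] :* gamma x i)%g.

Local Notation kG := (group_alg k gT).
Local Notation HHl := (HH_actl k (gT := gT)).
Local Notation HHr := (HH_actr k (gT := gT)).
Local Notation HHZ := (cocycles HHl HHr).
Local Notation HHB := (coboundaries HHl HHr).
Local Notation homHH := (homog HHl HHr).
Local Notation homC x := (homog (@triv_act k (centr x)) (@triv_act k (centr x))).
Local Notation I := {x : gT | x \in X}.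

Lemma reps_conj w : exists (x : I) y, w = (val x ^ y)%g.
Proof.
case/and3P: X_reps => _ _ /forall_inP/(_ _ (mem_classes (in_setT w)))/cards1P[x eq_x].
have /setIP[Xx /imsetP[y _ eq_y]] : x \in X :&: (w ^: [set: gT])%g by rewrite eq_x set11.
by exists (Sub x Xx : I), y^-1%g; rewrite /= eq_y conjgK.
Qed.

Lemma reps_uniq (x x' : I) y y' : (val x ^ y)%g = (val x' ^ y')%g -> x = x'.
Proof.
move=> eq_xy; apply: val_inj.
case/and3P: X_reps => _ _ /forall_inP/(_ _ (mem_classes (in_setT (val x))))/cards1P[z eq_z].
have : val x \in [set z] by rewrite -eq_z inE class_refl (valP x).
have : val x' \in [set z].
  rewrite -eq_z inE (valP x'); apply/imsetP; exists (y * y'^-1)%g => //.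
  by rewrite conjgM eq_xy conjgK.
by move=> /set1P-> /set1P->.
Qed.

Lemma homHH_inj n (phi psi : Map gT kG n) :
  (forall (x : I) s, homHH phi s (val x) = homHH psi s (val x)) -> phi = psi.
Proof.
move=> eq_h; apply: (homog_inj (@HH_actl1 _ _) (@HH_actr1 _ _) (@HH_actrM _ _)) => s.
by apply/ffunP=> u; have [x [y ->]] := reps_conj u; rewrite !homHH_conj eq_h.
Qed.

(** For x in [X] the cosets cover the group, so the default 1 is not reached. *)
Definition coset_rep (x g : gT) : gT :=
  if [pick s | g \in ('C[x] :* gamma x s)%g] is Some s then gamma x s else 1%g.

Definition retract (x g : gT) : centr x := subg 'C[x] (g * (coset_rep x g)^-1)%g.

Section Retraction.
Variable x : gT.
Hypothesis Xx : x \in X.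

Lemma coset_rep_eq s g : g \in ('C[x] :* gamma x s)%g -> coset_rep x g = gamma x s.
Proof.
have [i [Ci uniq_i]] := gamma_cosets Xx g.
rewrite /coset_rep; case: pickP => [s' /uniq_i <- /uniq_i <-//|/(_ i)].
by rewrite Ci.
Qed.

Lemma coset_repP g : (g * (coset_rep x g)^-1)%g \in 'C[x]%g.
Proof.
have [i [Ci _]] := gamma_cosets Xx g.
by rewrite (coset_rep_eq Ci) -mem_rcoset.
Qed.

Lemma coset_repMl c g : c \in 'C[x]%g -> coset_rep x (c * g)%g = coset_rep x g.
Proof.
move=> Cc; have [i [Ci _]] := gamma_cosets Xx g.
rewrite (coset_rep_eq Ci); apply: coset_rep_eq.
by move: Ci; rewrite !mem_rcoset -mulgA (groupMl _ Cc).
Qed.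

Lemma val_retract g : sgval (retract x g) = (g * (coset_rep x g)^-1)%g.
Proof. by rewrite subgK ?coset_repP. Qed.

Lemma retractMl (c : centr x) g : retract x (sgval c * g)%g = (c * retract x g)%g.
Proof.
have Cc : sgval c \in 'C[x]%g by exact: subgP.
by apply: val_inj; rewrite /= val_retract coset_repMl // -mulgA -val_retract.
Qed.

Lemma retract_id (c : centr x) : retract x (sgval c) = c.
Proof.
have Cc : sgval c \in 'C[x]%g by exact: subgP.
have lt0 : (0 < #|(x ^: [set: gT])%g|)%N by rewrite (cardD1 x) class_refl.
apply: val_inj; rewrite /= val_retract (coset_rep_eq (s := Ordinal lt0)).
  by rewrite (gamma_1 Xx) // invg1 mulg1.
by rewrite (gamma_1 Xx) // mem_rcoset invg1 mulg1.
Qed.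

End Retraction.

(* Inverse to taking homogeneous coefficients; the picked y, unique up to C_G(x),
   does not matter when Theta x is invariant under C_G(x). *)
Definition dehom n (Theta : I -> (nat -> gT) -> k^o) : Map gT kG n :=
  [ffun t : {ffun 'I_n -> nontriv gT} => [ffun u =>
     if [pick xy : I * gT | u == (val xy.1 ^ xy.2 * \prod_(l < n) val (t l))%g] is Some xy
     then Theta xy.1 (path_simp xy.2 [ffun i => val (t i)]) else 0] : kG].

Lemma homHH_dehom n (Theta : I -> (nat -> gT) -> k^o) (x : I) s :
    dim_ext n (Theta x) -> normalized n (Theta x) ->
    (forall c s, c \in 'C[val x]%g -> Theta x (fun j => c * s j)%g = Theta x s) ->
  homHH (dehom n Theta) s (val x) = Theta x s.
Proof.
move=> extT nT invT; rewrite homHH_apply.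
have [[i]|[t eq_t]] := nontrivP (edges n s).
  move=> ei1; rewrite (mapev_degen _ ei1) ffunE (nT s i) //.
  by move/eqP: ei1; rewrite ffunE -eq_mulVg1 => /eqP.
have eq_val : [ffun i => val (t i)] = edges n s.
  by apply/ffunP=> i; rewrite eq_t ffunE.
have -> : ((s 0%N)^-1 * val x * s n)%g = (val x ^ s 0%N * \prod_(l < n) val (t l))%g.
  have -> : (\prod_(l < n) val (t l) = (s 0%N)^-1 * s n)%g.
    by rewrite -prod_edges; apply: eq_bigr => l _; rewrite eq_t.
  by rewrite conjgE !mulgA mulgK.
rewrite (mapev_nontriv _ eq_t) !ffunE.
case: pickP => [[x' y] /= /eqP/mulIg eq_xy|/(_ (x, s 0%N))]; last by rewrite eqxx.
have eqx := reps_uniq eq_xy; rewrite -{x'}eqx in eq_xy *.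
(* The picked y and the vertex s 0 conjugate x to the same element, so y (s 0)^-1 centralizes x;
   translating by it moves s to the path starting at y. *)
rewrite eq_val -(invT (y * (s 0%N)^-1)%g s); last first.
  have xc : (val x ^ (y * (s 0%N)^-1) = val x)%g by rewrite conjgM -eq_xy conjgK.
  by apply/cent1P; rewrite /commute [RHS]conjgC xc.
apply: extT => j le_jn; rewrite -[in RHS](path_edges s le_jn) /path_simp.
by rewrite -mulgA mulKg.
Qed.

Definition pullback (x : gT) n (psi : Map (centr x) k^o n) (s : nat -> gT) : k^o :=
  homC x psi (fun j => retract x (s j)).

Lemma pullback_ext x n (psi : Map (centr x) k^o n) : dim_ext n (pullback psi).
Proof. by move=> s s' eq_s; apply: homog_ext => i le_in; rewrite eq_s. Qed.

Lemma pullback_normalized x n (psi : Map (centr x) k^o n) : normalized n (pullback psi).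
Proof. by move=> s i lt_in eq_s; apply: (homog_normalized _ _ _ lt_in); rewrite eq_s. Qed.

Lemma pullbackMl (x : I) n (psi : Map (centr (val x)) k^o n) c s : c \in 'C[val x]%g ->
  pullback psi (fun j => c * s j)%g = pullback psi s.
Proof.
move=> Cc; rewrite /pullback -[RHS](homC_mull _ (subg 'C[val x] c)).
by apply: homog_ext => i _; rewrite -retractMl ?(valP x) // subgK.
Qed.

Lemma pullback_diff x n (psi : Map (centr x) k^o n) s :
  pullback (bar_diff (@triv_act k _) (@triv_act k _) psi) s = simp_diff n (pullback psi) s.
Proof.
rewrite /pullback homC_diff.
exact: (simp_diff_map (retract x) s (homog_ext (triv_act k (gT := _)) (triv_act k (gT := _)) psi)).
Qed.

Definition shapiro n (psi : forall x : I, Map (centr (val x)) k^o n) : Map gT kG n :=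
  dehom n (fun x => pullback (psi x)).

Lemma homHH_shapiro n (psi : forall x : I, Map (centr (val x)) k^o n) (x : I) s :
  homHH (shapiro psi) s (val x) = pullback (psi x) s.
Proof.
by apply: homHH_dehom; [exact: pullback_ext|exact: pullback_normalized|exact: pullbackMl].
Qed.

(** The retraction is the identity on C_G(x), because the representative of the trivial coset is
    1. *)
Lemma hat_shapiro n (psi : forall x : I, Map (centr (val x)) k^o n) (x : I) :
  hat (val x) (shapiro psi) = psi x.
Proof.
apply: homC_inj => c; rewrite hat_homog homHH_shapiro.
by apply: homog_ext => i _; rewrite retract_id ?(valP x).
Qed.

Lemma shapiro_diff n (psi : forall x : I, Map (centr (val x)) k^o n) :
  shapiro (fun x => bar_diff (@triv_act k _) (@triv_act k _) (psi x)) =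
  bar_diff HHl HHr (shapiro psi).
Proof.
apply: homHH_inj => x s; rewrite homHH_shapiro homHH_diff pullback_diff simp_diff_coef.
by apply: eq_simp_diff => s'; rewrite homHH_shapiro.
Qed.

(** Let F be the coefficient of the homogeneous form at x. Then F o r is the pullback of the hat,
    say the differential of the pullback of psi, and F o r - F is the differential of the prism
    operator on F. So F is the differential of the difference [Theta], which is invariant and
    therefore comes from a cochain. *)
Lemma hat_coboundary_inj n (phi : Map gT kG n) : phi \in HHZ n ->
    (forall x : I, hat (val x) phi \in
       coboundaries (@triv_act k (centr (val x))) (@triv_act k (centr (val x))) n) ->
  phi \in HHB n.
Proof.
move=> Zphi Bhat.
pose F (x : I) s : k^o := homHH phi s (val x).
pose r (x : I) g : gT := sgval (retract (val x) g).
have cF x s : simp_diff n (F x) s = 0.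
  rewrite -simp_diff_coef.
  by rewrite (cocycle_homog (@HH_actlM _ _) (@HH_actrM _ _) (@HH_actlr _ _) _ Zphi) ffunE.
have rF x s : F x (r x \o s) = pullback (hat (val x) phi) s.
  by rewrite /pullback hat_homog.
case: n phi Zphi Bhat @F cF rF => [|n] phi Zphi Bhat F cF rF.
  rewrite memv0; apply/eqP; apply: homHH_inj => x s; rewrite homog0 [RHS]ffunE -/(F x s).
  have := Bhat x; rewrite memv0 => /eqP hat0.
  (* In degree 0 the hat itself is zero. The cocycle condition on the edge from s 0 to r (s 0)
     equates the values at its two ends, and the value at r (s 0) comes from the hat. *)
  have := cF x (fun j => if j is 0 then s 0%N else r x (s 0%N)).
  rewrite /simp_diff !big_ord_recl big_ord0 addr0 expr0 expr1 scale1r scaleN1r.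
  have -> : F x (face 0 (fun j => if j is 0 then s 0%N else r x (s 0%N))) = 0.
    transitivity (F x (r x \o s)); last by rewrite rF hat0 /pullback homog0.
    by apply: homHH_coef_ext => -[|i].
  have -> : F x (face 1 (fun j => if j is 0 then s 0%N else r x (s 0%N))) = F x s.
    by apply: homHH_coef_ext => -[|i].
  by move/eqP; rewrite add0r oppr_eq0 => /eqP.
have [psi eq_psi] := fin_all_exists (fun x => coboundaryP (Bhat x)).
pose Theta (x : I) s := pullback (psi x) s - prism_op (r x) n (F x) s.
have extF x : dim_ext n.+1 (F x) by exact: homHH_coef_ext.
have hTheta (x : I) s : homHH (dehom n Theta) s (val x) = Theta x s.
  apply: homHH_dehom; [move=> s1 s2 eq_s|move=> s' i lt_in eq_s|move=> c s' Cc]; rewrite /Theta.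
  - by rewrite (prism_op_ext _ (extF x) eq_s) (pullback_ext _ eq_s).
  - rewrite (pullback_normalized _ lt_in eq_s) (prism_op_normalized _ _ lt_in eq_s) ?subr0 //.
    exact: homHH_coef_normalized.
  - apply: (f_equal2 (fun u v : k^o => u - v)); first exact: pullbackMl.
    (* The prism operator preserves invariance since r commutes with left multiplication by
       C_G(x). *)
    apply: (@prism_op_map _ _ _ _ (fun g => c * g)%g _ _ _ (extF x)) => [g|s1].
      by rewrite /r !val_retract ?(valP x) // coset_repMl ?(valP x) // mulgA.
    exact: homHH_mull.
rewrite (_ : phi = bar_diff HHl HHr (dehom n Theta)) ?coboundary_diff //.
apply: homHH_inj => x s; rewrite homHH_diff simp_diff_coef (eq_simp_diff _ _ (hTheta x)).
rewrite /Theta simp_diffB -prism_homotopy // -pullback_diff -eq_psi -rF.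
by rewrite opprB addrCA subrr addr0.
Qed.

(** * The induced maps on cohomology classes *)

Local Notation CZ x := (cocycles (@triv_act k (centr x)) (@triv_act k (centr x))).
Local Notation CB x := (coboundaries (@triv_act k (centr x)) (@triv_act k (centr x))).

Definition grp_cls (x : gT) n (psi : Map (centr x) k^o n) : grpH k (centr x) n :=
  sq_class (CZ x n) (CB x n) psi.

Definition grp_rep (x : gT) n (a : grpH k (centr x) n) : Map (centr x) k^o n := sq_rep a.

Lemma grp_cls_linear (x : gT) n : linear (@grp_cls x n).
Proof. exact: sq_class_linear. Qed.

Lemma grp_cls_eq (x : gT) n (phi psi : Map (centr x) k^o n) :
  phi \in CZ x n -> psi \in CZ x n ->
  (grp_cls phi == grp_cls psi) = (phi - psi \in CB x n).
Proof. exact: sq_class_eq. Qed.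

Lemma hat_cocycle x n (phi : Map gT kG n) : phi \in HHZ n -> hat x phi \in CZ x n.
Proof.
move=> /cocyclesP Zphi; apply/cocyclesP; rewrite -hat_diff Zphi.
by apply: homC_inj => c; rewrite hat_homog !homog0 [LHS]ffunE.
Qed.

Lemma hatB x n (phi psi : Map gT kG n) : hat x (phi - psi) = hat x phi - hat x psi.
Proof. by rewrite addrC -scaleN1r hat_linear scaleN1r addrC. Qed.

Lemma hat_coboundary x n (phi : Map gT kG n) : phi \in HHB n -> hat x phi \in CB x n.
Proof.
case: n phi => [|n] phi.
  rewrite !memv0 => /eqP->; apply/eqP; apply: homC_inj => c.
  by rewrite hat_homog !homog0 [LHS]ffunE.
by case/coboundaryP=> psi ->; rewrite hat_diff coboundary_diff.
Qed.

(** Taking the hats of one cocycle at all representatives replaces splitting it along the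
    subcomplexes [in_Hx]: by [hat_in_Hx], the hat at y vanishes on the components belonging to other
    classes. *)
Definition HH_to_centrH n (c : HH k gT n) : centrH k X n :=
  [ffun x : I => grp_cls (hat (val x) (HH_rep c))].

Lemma HH_to_centrH_cls n (phi : Map gT kG n) (x : I) : phi \in HHZ n ->
  HH_to_centrH (HH_cls phi) x = grp_cls (hat (val x) phi).
Proof.
move=> Zphi; rewrite ffunE; apply/eqP.
rewrite grp_cls_eq ?hat_cocycle ?HH_rep_cocycle // -hatB.
by apply: hat_coboundary; rewrite -HH_cls_eq ?HH_rep_cocycle // HH_repK.
Qed.

Lemma HH_to_centrH_linear n : linear (@HH_to_centrH n).
Proof.
move=> a u v; apply/ffunP=> x; rewrite -[u]HH_repK -[v]HH_repK -HH_cls_linear.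
rewrite HH_to_centrH_cls ?rpredD ?rpredZ ?HH_rep_cocycle // [RHS]ffunE [in RHS]ffunE.
rewrite !HH_to_centrH_cls ?HH_rep_cocycle // hat_linear.
exact: grp_cls_linear.
Qed.

HB.instance Definition _ n := GRing.isLinear.Build k (HH k gT n) (centrH k X n) _
  (@HH_to_centrH n) (@HH_to_centrH_linear n).

Definition centrH_to_HH n (d : centrH k X n) : HH k gT n :=
  HH_cls (shapiro (fun x => grp_rep (d x))).

Lemma shapiro_cocycle n (psi : forall x : I, Map (centr (val x)) k^o n) :
  (forall x, psi x \in CZ (val x) n) -> shapiro psi \in HHZ n.
Proof.
move=> Zpsi; apply/cocyclesP; rewrite -shapiro_diff; apply: homHH_inj => x s.
by rewrite homHH_shapiro /pullback (cocyclesP _ _ _ (Zpsi x)) !homog0 [RHS]ffunE.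
Qed.

Lemma centrH_to_HHK n : cancel (@centrH_to_HH n) (@HH_to_centrH n).
Proof.
move=> d; apply/ffunP=> x.
rewrite HH_to_centrH_cls ?hat_shapiro ?shapiro_cocycle // => [|y]; last exact: sq_rep_in.
exact: sq_repK.
Qed.

Lemma HH_to_centrH_inj n : injective (@HH_to_centrH n).
Proof.
move=> u v eq_uv; rewrite -[u]HH_repK -[v]HH_repK; apply/eqP.
rewrite HH_cls_eq ?HH_rep_cocycle //.
apply: hat_coboundary_inj => [|x]; first by rewrite rpredB ?HH_rep_cocycle.
rewrite hatB -grp_cls_eq ?hat_cocycle ?HH_rep_cocycle //.
by move/ffunP/(_ x): eq_uv; rewrite !ffunE => /eqP.
Qed.

Lemma HH_to_centrHK n : cancel (@HH_to_centrH n) (@centrH_to_HH n).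
Proof. by move=> c; apply: HH_to_centrH_inj; rewrite centrH_to_HHK. Qed.

Lemma centrH_to_HH_linear n : linear (@centrH_to_HH n).
Proof.
by move=> a u v; apply: HH_to_centrH_inj; rewrite HH_to_centrH_linear !centrH_to_HHK.
Qed.

HB.instance Definition _ n := GRing.isLinear.Build k (centrH k X n) (HH k gT n) _
  (@centrH_to_HH n) (@centrH_to_HH_linear n).

(** * The product formula on cochains *)

Section CosetParts.
Variables (x : gT) (Xx : x \in X) (i : 'I_#|(x ^: [set: gT])%g|).

(** By induction: if the partial product lies in C_G(x) gamma_s, its product with the next h lies in
    C_G(x) gamma_s h, which is the coset selected by [coset_step]. *)
Lemma path_coset_index n (g : {ffun 'I_n -> gT}) j : (j <= n)%N ->
  path_simp (gamma x i) g j \in ('C[x] :* gamma x (coset_index gamma i g j))%g.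
Proof.
elim: j => [|j IHj] lt_jn.
  by rewrite path_simp0 /coset_index take0 /= rcoset_refl.
have size_g : size (codom g) = n by rewrite size_codom card_ord.
rewrite /coset_index (take_nth 1%g) ?size_g // foldl_rcons -/(coset_index gamma i g j).
have -> : nth 1%g (codom g) j = g (Ordinal lt_jn).
  by rewrite (nth_map (Ordinal lt_jn)) ?size_enum_ord // (nth_ord_enum _ (Ordinal lt_jn)).
rewrite (path_simpS _ _ (Ordinal lt_jn)) /=; move: (IHj (ltnW lt_jn)).
set s := coset_index _ _ _ _; rewrite /coset_step.
have [s' [Cs' _]] := gamma_cosets Xx (gamma x s * g (Ordinal lt_jn))%g.
(* The default of [coset_step] is excluded, as some coset contains the product. *)
case: pickP => [{Cs'}s' Cs' /=|/(_ s')]; last by rewrite Cs'.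
rewrite !mem_rcoset in Cs' * => Cj.
by move: (groupM Cj Cs'); rewrite !mulgA mulgKV.
Qed.

(** The retraction sends a partial product p in C_G(x) gamma_s to p gamma_s^-1, and the quotient of
    two consecutive such values is gamma_s h gamma_(s')^-1. *)
Lemma coset_part_edges n (g : {ffun 'I_n -> gT}) :
  coset_part gamma i g = edges n (fun j => retract x (path_simp (gamma x i) g j)).
Proof.
apply/ffunP=> l; rewrite !ffunE; set rl := retract x _; set rl1 := retract x _.
suff -> : (gamma x (coset_index gamma i g l) * g l * (gamma x (coset_index gamma i g l.+1))^-1)%g
  = sgval (rl^-1 * rl1)%g by rewrite sgvalK.
have -> : sgval (rl^-1 * rl1)%g = ((sgval rl)^-1 * sgval rl1)%g by [].
rewrite !val_retract // (coset_rep_eq Xx (path_coset_index _ (ltnW (ltn_ord l)))).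
rewrite (coset_rep_eq Xx (path_coset_index _ (ltn_ord l))) path_simpS.
set c := gamma x _; set p := path_simp _ _ _.
by rewrite -[LHS](mulKg (p * c^-1)%g) !mulgA mulgKV.
Qed.

End CosetParts.

Definition single (x : I) n (psi : Map (centr (val x)) k^o n) (y : I) :
    Map (centr (val y)) k^o n :=
  dfwith (fun y : I => 0 : Map (centr (val y)) k^o n) psi y.

Lemma conj_coset_rep_inj (x : I) i j :
  (val x ^ gamma (val x) i = val x ^ gamma (val x) j)%g -> i = j.
Proof.
move=> eq_ij; have [l [_ uniq_l]] := gamma_cosets (valP x) (gamma (val x) i).
rewrite -(uniq_l i) ?rcoset_refl //; apply: uniq_l.
rewrite mem_rcoset; apply/cent1P; rewrite /commute [RHS]conjgC.
by rewrite conjgM eq_ij conjgK.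
Qed.

(** At most one term of the sum is nonzero, since the conjugates x_i are distinct; if u (g_1 ...
    g_n)^-1 is not conjugate to x, both sides vanish. The form as a sum over i is what produces the
    double sum of [cup_at]. *)
Lemma shapiro_single_coef (x : I) n (psi : Map (centr (val x)) k^o n)
    (g : {ffun 'I_n -> gT}) u :
  mapev (shapiro (single psi)) g u =
    \sum_i (u == val x ^ gamma (val x) i * \prod_(l < n) g l)%g%:R
             * mapev psi (coset_part gamma i g).
Proof.
have coefE y (x' : I) : u = (val x' ^ y * \prod_(l < n) g l)%g ->
    mapev (shapiro (single psi)) g u = pullback (single psi x') (path_simp y g).
  move=> ->; rewrite -homHH_shapiro homHH_apply edges_path path_simp0 path_simp_last.
  by rewrite conjgE !mulgA.
have [x' [y eq_u]] := reps_conj (u * (\prod_(l < n) g l)^-1)%g.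
have {}eq_u : u = (val x' ^ y * \prod_(l < n) g l)%g by rewrite -eq_u mulgKV.
have [eqx|neqx] := eqVneq x x'; last first.
  rewrite (coefE _ _ eq_u) /single dfwith_out // /pullback homog0 big1 // => i _.
  case: eqP => [|_]; last by rewrite mul0r.
  by rewrite eq_u => /mulIg/reps_uniq eqx; rewrite eqx eqxx in neqx.
rewrite -{x'}eqx in eq_u.
have [i [Ci _]] := gamma_cosets (valP x) y.
(* The element y and the representative of its coset differ by an element of C_G(x), so they
   conjugate x alike. *)
have {}eq_u : u = (val x ^ gamma (val x) i * \prod_(l < n) g l)%g.
  rewrite eq_u; congr (_ * _)%g; move: Ci => /rcosetP[c /cent1P cx ->].
  by rewrite conjgM [(_ ^ c)%g]conjgE -cx mulKg.
rewrite (coefE _ _ eq_u) /single dfwith_in (bigD1 i) //= [X in _ + X]big1 ?addr0 => [|j ji].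
  by rewrite eq_u eqxx mul1r coset_part_edges ?(valP x).
case: eqP => [|_]; last by rewrite mul0r.
by rewrite eq_u => /mulIg/conj_coset_rep_inj eq_ij; rewrite eq_ij eqxx in ji.
Qed.

(** The formula is an identity of cochains. The coefficient of z p p' in the product of the two
    values is a convolution, and the supports of the factors retain the pairs with x_i p y_j p' = z
    p p', that is, x_i p y_j p^-1 = z. *)
Lemma cup_at_shapiro (x y z : I) n m (phi : Map (centr (val x)) k^o n)
    (psi : Map (centr (val y)) k^o m) :
  cup_at gamma (val z) phi psi =
  hat (val z) (HH_cup (shapiro (single phi)) (shapiro (single psi))).
Proof.
(* Used with q = x_i p, v = z, w = y_j, a = p and b = p'. *)
have key (q v w a b : gT) : (q^-1 * (v * (a * b)) == w * b)%g = (q * w * a^-1 == v)%g.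
  apply/eqP/eqP => [|<-]; last by rewrite !mulgA mulgKV mulVg mul1g.
  by rewrite !mulgA => /mulIg <-; rewrite !mulgA mulgK mulgV mul1g.
apply/ffunP=> h; rewrite [LHS]ffunE [RHS]ffunE ga_eltMr invgK mapev_cup /=.
set g := [ffun l => ambient h (lshift m l)]; set g' := [ffun l => ambient h (rshift n l)].
have -> : (\prod_(l < n + m) ambient h l = (\prod_(l < n) g l) * \prod_(l < m) g' l)%g.
  by rewrite big_split_ord /=; congr (_ * _)%g; apply: eq_bigr => l _; rewrite [RHS]ffunE.
set p := (\prod_(l < n) g l)%g; set p' := (\prod_(l < m) g' l)%g.
rewrite ffunE.
pose b (u : gT) j : k :=
  (u == val y ^ gamma (val y) j * p')%g%:R * mapev psi (coset_part gamma j g').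
transitivity (\sum_i mapev phi (coset_part gamma i g) *
   \sum_j b ((val x ^ gamma (val x) i * p)^-1 * (val z * (p * p')))%g j).
  rewrite big_mkcond.
  pose c i j := if (val x ^ gamma (val x) i * p * val y ^ gamma (val y) j * p^-1)%g == val z
    then mapev phi (coset_part gamma i g) * mapev psi (coset_part gamma j g') else 0.
  rewrite -(pair_bigA _ c) /c.
  apply: eq_bigr => i _; rewrite mulr_sumr; apply: eq_bigr => j _; rewrite /b.
  by rewrite key; case: eqP => _; rewrite ?mul1r // mul0r mulr0.
under [RHS]eq_bigr do rewrite !shapiro_single_coef mulr_suml.
rewrite exchange_big; apply: eq_bigr => i _ /=.
(* For fixed i, the convolution only sees u = x_i p. *)
rewrite (bigD1 (val x ^ gamma (val x) i * p)%g) //= eqxx mul1r.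
by rewrite [X in _ + X]big1 ?addr0 // => u /negPf ->; rewrite !mul0r.
Qed.

Lemma single_cocycle (x : I) n (psi : Map (centr (val x)) k^o n) y :
  psi \in CZ (val x) n -> single psi y \in CZ (val y) n.
Proof.
move=> Zpsi; rewrite /single; have [<-|neq] := eqVneq x y; first by rewrite dfwith_in.
by rewrite dfwith_out // mem0v.
Qed.

(** Exhibits a cocycle whose class is the preimage of an element of a single summand, so that the
    transported product can be evaluated on cochains. *)
Lemma dsum_in_single (x : I) n (psi : Map (centr (val x)) k^o n) : psi \in CZ (val x) n ->
  (dsum_in (V := fun x : I => grpH k (centr (val x)) n) (grp_cls psi) : centrH k X n) =
  HH_to_centrH (HH_cls (shapiro (single psi))).
Proof.
move=> Zpsi; apply/ffunP=> y; rewrite HH_to_centrH_cls; last first.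
  by apply: shapiro_cocycle => z; exact: single_cocycle.
rewrite hat_shapiro ffunE /single; have [<-|neq] := eqVneq x y; first by rewrite !dfwith_in.
rewrite !dfwith_out //; symmetry; exact: raddf0.
Qed.

Lemma in_Hx_coef (x : gT) n (phi : Map gT kG n) (t : {ffun 'I_n -> nontriv gT}) u :
  in_Hx x phi -> phi t u != 0 -> u \in ((\prod_(l < n) val (t l)) *: (x ^: [set: gT]))%g.
Proof.
move=> /(_ t) Hphi; apply: contraNT => Cu; move: Hphi.
move=> /coord_span ->; rewrite sum_ffunE big1 // => i _; rewrite !ffunE.
set S := image_tuple _ _; have : S`_i \in S by rewrite mem_nth ?size_tuple.
case/imageP=> a Ca ->; rewrite ffunE; case: eqP Ca Cu => [-> -> //|_ _ _].
exact: mulr0.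
Qed.

(** With p = h_1 ... h_n, the hat at y reads the coefficient of y p. If it is nonzero, y p lies in p
    C_x, so y^p is conjugate to x, and two representatives of one class coincide. *)
Lemma hat_in_Hx (x y : I) n (phi : Map gT kG n) : in_Hx (val x) phi -> x != y ->
  hat (val y) phi = 0.
Proof.
move=> Hphi neq_xy; apply/ffunP=> t; rewrite [LHS]ffunE [RHS]ffunE ga_eltMr invgK.
have [[i gi1]|[t' eq_t]] := nontrivP (ambient t); first by rewrite (mapev_degen _ gi1) ffunE.
rewrite (mapev_nontriv _ eq_t); apply/eqP; apply: contraNT neq_xy => /(in_Hx_coef Hphi).
have -> : (\prod_(l < n) val (t' l) = \prod_(l < n) ambient t l)%g.
  by apply: eq_bigr => l _; rewrite eq_t.
rewrite mem_lcoset -conjgE => /imsetP[w _ eq_w].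
by rewrite (reps_uniq eq_w).
Qed.

Definition HH_to_centrHL n : {linear HH k gT n -> centrH k X n} := @HH_to_centrH n.
Definition centrH_to_HHL n : {linear centrH k X n -> HH k gT n} := @centrH_to_HH n.

Definition centrH_algebra : graded_algebra (centrH k X) :=
  transport_algebra (HH_algebra k gT) (F := HH_to_centrHL) (E := centrH_to_HHL)
    HH_to_centrHK centrH_to_HHK.

Lemma grp_classP (x : gT) n (psi : Map (centr x) k^o n) c :
  grpH_class psi c <-> psi \in CZ x n /\ c = grp_cls psi.
Proof. exact: is_classP. Qed.

Lemma gmul_dsum_in (x y z : I) n m (phi : Map (centr (val x)) k^o n)
    (psi : Map (centr (val y)) k^o m) a b :
  grpH_class phi a -> grpH_class psi b ->
  grpH_class (cup_at gamma (val z) phi psi)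
    (gmul centrH_algebra (dsum_in a : centrH k X n) (dsum_in b : centrH k X m) z).
Proof.
move=> /grp_classP[Zphi ->] /grp_classP[Zpsi ->].
have Sphi : shapiro (single phi) \in HHZ n.
  by apply: shapiro_cocycle => x'; exact: single_cocycle.
have Spsi : shapiro (single psi) \in HHZ m.
  by apply: shapiro_cocycle => x'; exact: single_cocycle.
apply/grp_classP; rewrite cup_at_shapiro hat_cocycle ?HH_cup_cocycle //; split=> //.
rewrite !dsum_in_single //= /transport_mul /= !HH_to_centrHK HH_mul_cls //.
by rewrite HH_to_centrH_cls ?HH_cup_cocycle.
Qed.

Lemma HH_to_centrH_in_Hx (x : I) n (phi : Map gT kG n) c :
    in_Hx (val x) phi -> HH_class phi c ->
  exists2 d : grpH k (centr (val x)) n, grpH_class (hat (val x) phi) d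
    & HH_to_centrH c = dsum_in d.
Proof.
move=> Hphi /HH_classP[Zphi ->]; exists (grp_cls (hat (val x) phi)).
  by apply/grp_classP; rewrite hat_cocycle.
apply/ffunP=> y; rewrite HH_to_centrH_cls // ffunE; have [<-|neq] := eqVneq x y.
  by rewrite dfwith_in.
rewrite dfwith_out // (hat_in_Hx Hphi neq); exact: raddf0.
Qed.

End Shapiro.

Theorem theorem7p1 (k : fieldType) (gT : finGroupType) (X : {set gT})
    (gamma : forall x : gT, 'I_#|(x ^: [set: gT])%g| -> gT)
    (X_reps : is_transversal X (classes [set: gT]) [set: gT])
    (gamma_1 : forall x, x \in X ->
       forall i : 'I_#|(x ^: [set: gT])%g|, i = 0%N :> nat -> gamma x i = 1%g)
    (gamma_cosets : forall x, x \in X ->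
       forall g, exists! i, g \in ('C[x] :* gamma x i)%g) :
  exists (A : graded_algebra (HH k gT)) (B : graded_algebra (centrH k X))
         (F : forall n, {linear HH k gT n -> centrH k X n}),
  [/\ (* the product of A is the cup product *)
      forall n m (phi : Map gT (group_alg k gT) n) (psi : Map gT (group_alg k gT) m) a b,
        HH_class phi a -> HH_class psi b ->
        HH_class (HH_cup phi psi) (gmul A a b),
      (* the product of B is induced by the formula for the cochains *)
      forall (x y : {x : gT | x \in X}) n m
        (phi : Map (centr (val x)) k^o n) (psi : Map (centr (val y)) k^o m)
        (a : grpH k (centr (val x)) n) (b : grpH k (centr (val y)) m),
        grpH_class phi a -> grpH_class psi b ->
        forall z : {x : gT | x \in X},
          grpH_class (cup_at gamma (val z) phi psi)
            (gmul B (dsum_in a : centrH k X n) (dsum_in b : centrH k X m) z),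
      (* F maps the class of phi_x to the class of its hat *)
      forall (x : {x : gT | x \in X}) n (phi : Map gT (group_alg k gT) n) c,
        in_Hx (val x) phi -> HH_class phi c ->
        exists2 d : grpH k (centr (val x)) n,
          grpH_class (hat (val x) phi) d & F n c = dsum_in d
    & graded_algebra_iso A B F].
Proof.
exists (HH_algebra k gT), (centrH_algebra k X_reps gamma_1 gamma_cosets), (@HH_to_centrHL k gT X).
split=> [n m phi psi a b /HH_classP[Zphi ->] /HH_classP[Zpsi ->]|||].
- by apply/HH_classP; rewrite HH_cup_cocycle //= HH_mul_cls.
- by move=> x y n m phi psi a b clphi clpsi z; exact: gmul_dsum_in.
- by move=> x n phi c Hphi clphi; exact: HH_to_centrH_in_Hx.
- exact: transport_iso.
Qed.
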